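(* Let $d\in\mathbb{N}$, $m\in\mathbb{N}_0$, $\lambda>\frac12$, and let a hyperbolic cross $I_N^d$ with $N\ge2^{d+1}$ and a reconstructing rank-1 lattice $\Lambda(\mathbf{z},M,I_N^d)$ be given. Let $\psi(\mathbf{x})=(\psi_1(x_1),\ldots,\psi_d(x_d))^\top$ be a multivariate transformation with density function $\varrho(\mathbf{y})=\prod_{j=1}^d\varrho_j(y_j)$, let $\omega(\mathbf{y})=\prod_{j=1}^d\omega_j(y_j)$ be a product weight function, and let $h\in L_2(\mathbb{R}^d,\omega)\cap H^m_{\mathrm{mix}}(\mathbb{R}^d)$. Assume that for all multi-indices $\mathbf{m}=(m_1,\ldots,m_d)^\top\in\mathbb{N}_0^d$ with $\|\mathbf{m}\|_{\ell_\infty}\le m$, all $\ell=1,\ldots,d$ and all $j_\ell=0,\ldots,m$ $$\varrho_\ell^{(j_\ell)}\in\mathcal{C}_0(\mathbb{R}),\qquad\psi_\ell^{(j_\ell)}\in\mathcal{C}\left((-\tfrac12,\tfrac12)\right)$$ and $$\max_{j_\ell=0,\ldots,m_\ell}\left\|\frac{\mathrm{d}^{m_\ell-j_\ell}}{\mathrm{d}x_\ell^{m_\ell-j_\ell}}\left[\sqrt{(\omega_\ell\circ\psi_\ell)\,\psi_\ell'}\right](x_\ell)\;\psi_\ell'(x_\ell)^{\max(-\frac12,\,2j_\ell-\frac32)}\right\|_{L_\infty(\mathbb{T})}<\infty.$$ Then $$\left\|h-S^\Lambda_{I_N^d}h\right\|_{L_\infty\left(\mathbb{R}^d,\sqrt{\omega/\varrho}\right)}\lesssim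 N^{-m+\lambda}\,\|h\|_{\mathcal{H}^m(\mathbb{R}^d)}.$$
   Context: $A\lesssim B$ means $A\le C\,B$ with a constant $C>0$ that does not depend on $N$, on the lattice, or on $h$. Torus, transformations and weights. $\mathbb{T}^d\simeq[-\frac12,\frac12)^d$. A univariate transformation is a map $\psi_j:(-\frac12,\frac12)\to\mathbb{R}$ that is continuously differentiable, strictly increasing, odd, and satisfies $\lim_{x\to-1/2}\psi_j(x)=-\infty$, $\lim_{x\to1/2}\psi_j(x)=\infty$; its density function is $\varrho_j(y):=(\psi_j^{-1})'(y)=\frac{1}{\psi_j'(\psi_j^{-1}(y))}$. A multivariate transformation acts componentwise by univariate transformations $\psi_1,\ldots,\psi_d$, with density $\varrho(\mathbf{y})=\prod_j\varrho_j(y_j)$ and $\psi'(\mathbf{x})=\prod_j\psi_j'(x_j)$. A product weight function has univariate factors $\omega_j:\mathbb{R}\to[0,\infty)$. Function spaces. $\mathcal{C}_0(\mathbb{R})$: continuous functions $\mathbb{R}\to\mathbb{C}$ vanishing at infinity; $\mathcal{C}((-\frac12,\frac12))$: continuous functions. A superscript $(j)$ denotes the $j$-th derivative of a univariate function; $\|\mathbf{m}\|_{\ell_\infty}=\max_j|m_j|$. $L_2(\mathbb{R}^d,\omega)=\{h\in L_2(\mathbb{R}^d):\|h\|_{L_2(\mathbb{R}^d,\omega)}^2:=\int_{\mathbb{R}^d}|h|^2\omega\,\mathrm{d}\mathbf{y}<\infty\}$. $\|g\|_{L_\infty(\mathbb{R}^d,\sqrt{\omega/\varrho})}:=\operatorname{ess\,sup}_{\mathbf{y}\in\mathbb{R}^d}\sqrt{\omega(\mathbf{y})/\varrho(\mathbf{y})}\,|g(\mathbf{y})|$.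 $H^m_{\mathrm{mix}}(\mathbb{R}^d)$ is the space of $h\in L_2(\mathbb{R}^d)$ with $\sum_{\|\boldsymbol{\alpha}\|_{\ell_\infty}\le m}\|D^{\boldsymbol{\alpha}}[h]\|_{L_2(\mathbb{R}^d)}^2<\infty$, the sum running over $\boldsymbol{\alpha}\in\mathbb{N}_0^d$, where $D^{\boldsymbol{\alpha}}=\frac{\partial^{\alpha_1}}{\partial x_1^{\alpha_1}}\cdots\frac{\partial^{\alpha_d}}{\partial x_d^{\alpha_d}}$. Frequency sets and lattices. $\omega_{\mathrm{hc}}(\mathbf{k}):=\prod_{j=1}^d\max(1,|k_j|)$ for $\mathbf{k}\in\mathbb{Z}^d$; for $N\in\mathbb{N}$ the hyperbolic cross is $I_N^d:=\{\mathbf{k}\in\mathbb{Z}^d:\omega_{\mathrm{hc}}(\mathbf{k})\le N\}$. For $\mathbf{z}\in\mathbb{Z}^d$, $M\in\mathbb{N}$ the rank-1 lattice is $\Lambda(\mathbf{z},M):=\{\mathbf{x}_j:=\frac{j}{M}\mathbf{z}\bmod\mathbf{1}\in\mathbb{T}^d:j=0,\ldots,M-1\}$, with points represented in $[-\frac12,\frac12)^d$ before applying $\psi$. It is a reconstructing rank-1 lattice for a finite set $I\subset\mathbb{Z}^d$, denoted $\Lambda(\mathbf{z},M,I)$, if $\mathbf{t}\cdot\mathbf{z}\not\equiv0\pmod M$ for all $\mathbf{t}\in\{\mathbf{k}_1-\mathbf{k}_2:\mathbf{k}_1,\mathbf{k}_2\in I\}\setminus\{\mathbf{0}\}$. The transformed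 lattice points are $\mathbf{y}_j:=\psi(\mathbf{x}_j)$. Fourier objects on $\mathbb{R}^d$. $\varphi_{\mathbf{k}}(\mathbf{y}):=\sqrt{\frac{\varrho(\mathbf{y})}{\omega(\mathbf{y})}}\,\mathrm{e}^{2\pi\mathrm{i}\mathbf{k}\cdot\psi^{-1}(\mathbf{y})}$; the Fourier coefficients of $h$ are $\hat h_{\mathbf{k}}:=\int_{\mathbb{R}^d}h(\mathbf{y})\,\overline{\varphi_{\mathbf{k}}(\mathbf{y})}\,\omega(\mathbf{y})\,\mathrm{d}\mathbf{y}=\int_{\mathbb{R}^d}h(\mathbf{y})\sqrt{\varrho(\mathbf{y})\omega(\mathbf{y})}\,\mathrm{e}^{-2\pi\mathrm{i}\mathbf{k}\cdot\psi^{-1}(\mathbf{y})}\,\mathrm{d}\mathbf{y}$, and $\|h\|_{\mathcal{H}^m(\mathbb{R}^d)}:=\left(\sum_{\mathbf{k}\in\mathbb{Z}^d}\omega_{\mathrm{hc}}(\mathbf{k})^{2m}|\hat h_{\mathbf{k}}|^2\right)^{1/2}$. The approximated Fourier coefficients and partial sum are $$\hat h^\Lambda_{\mathbf{k}}:=\frac1M\sum_{j=0}^{M-1}h(\mathbf{y}_j)\sqrt{\frac{\omega(\mathbf{y}_j)}{\varrho(\mathbf{y}_j)}}\,\mathrm{e}^{-2\pi\mathrm{i}\mathbf{k}\cdot\psi^{-1}(\mathbf{y}_j)}=\frac1M\sum_{j=0}^{M-1}f(\mathbf{x}_j)\,\mathrm{e}^{-2\pi\mathrm{i}\mathbf{k}\cdot\mathbf{x}_j},\qquad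 S_I^\Lambda h(\mathbf{y}):=\sum_{\mathbf{k}\in I}\hat h^\Lambda_{\mathbf{k}}\,\varphi_{\mathbf{k}}(\mathbf{y}),$$ where $f(\mathbf{x}):=h(\psi(\mathbf{x}))\sqrt{\omega(\psi(\mathbf{x}))\,\psi'(\mathbf{x})}$ is the transformed function on $\mathbb{T}^d$. When sampled, $f$ is identified with its continuous representative given by its Fourier series.
   Formalization: The formal theorem takes m ≥ 1 instead of m ∈ ℕ_0; for m = 0 the bound fails, since a narrow bump of height 1 missing the lattice points has error 1 but arbitrarily small H^0 (i.e. L_2) norm. *)

(* Defs.v *)
From HB Require Import structures.
From mathcomp Require Import all_boot all_order all_algebra.
From mathcomp Require Import all_classical all_reals all_analysis.
From mathcomp Require Import ess_sup_inf complex.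

Set Implicit Arguments.
Unset Strict Implicit.
Unset Printing Implicit Defensive.

Import Order.TTheory GRing.Theory Num.Theory.
Import numFieldTopology.Exports numFieldNormedType.Exports.

Local Open Scope classical_set_scope.
Local Open Scope ring_scope.

(* 'rV[R]_n carries the product sigma-algebra, generated by the coordinates,
   i.e. the Borel sigma-algebra of R^n. *)
Definition rV_display : measure_display.
Proof. exact: default_measure_display. Qed.

Section rV_measurable.
Context (R : realType) (n : nat).

Let coords : 'I_n -> 'rV[R]_n -> R := fun i v => v ord0 i.

Let rV_set0 : g_sigma_preimage coords set0.
Proof. exact: sigma_algebra0. Qed.

Let rV_setC A : g_sigma_preimage coords A -> g_sigma_preimage coords (~` A).
Proof. exact: sigma_algebraC. Qed.

Let rV_bigcup (F : _^nat) : (forall i, g_sigma_preimage coords (F i)) ->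
  g_sigma_preimage coords (\bigcup_i (F i)).
Proof. exact: sigma_algebra_bigcup. Qed.

HB.instance Definition _ := @isMeasurable.Build rV_display
  'rV[R]_n (g_sigma_preimage coords) rV_set0 rV_setC rV_bigcup.

End rV_measurable.

Lemma sigma_finite_prod d1 d2 (T1 : measurableType d1) (T2 : measurableType d2)
    (R : realType) (m1 : {sigma_finite_measure set T1 -> \bar R})
    (m2 : {sigma_finite_measure set T2 -> \bar R}) :
  sigma_finite setT (m1 \x m2)%E.
Proof.
have /sigma_finiteP[F [TF ndF Foo]] := sigma_finiteT m1.
have /sigma_finiteP[G [TG ndG Goo]] := sigma_finiteT m2.
exists (fun n => F n `*` G n).
  rewrite -setXTT TF TG predeqE => -[x y]; split.
    move=> [/= [n _ Fnx] [k _ Gky]]; exists (maxn n k) => //; split.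
    - by move: x Fnx; exact/subsetPset/ndF/leq_maxl.
    - by move: y Gky; exact/subsetPset/ndG/leq_maxr.
  by move=> [n _ []/= ? ?]; split; exists n.
move=> k; have [? ?] := Foo k; have [? ?] := Goo k.
split; first exact: measurableX.
by rewrite product_measure1E// lte_mul_pinfty// ge0_fin_numE.
Qed.

Section lebesgue_Rn.
Context (R : realType).

Definition tcons n (p : R * n.-tuple R) : n.+1.-tuple R :=
  [the n.+1.-tuple R of p.1 :: p.2].

Lemma measurable_tcons n : measurable_fun [set: R * n.-tuple R] (@tcons n).
Proof. by apply: measurable_cons. Qed.

Definition tuple_row n (t : n.-tuple R) : 'rV[R]_n := \row_i tnth t i.

Lemma measurable_tuple_row n : measurable_fun [set: n.-tuple R] (@tuple_row n).
Proof.
apply: (measurability (\big[setU/set0]_(i < n)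
  preimage_set_system setT (fun v : 'rV[R]_n => v ord0 i) measurable)).
  by [].
move=> _ [A + <-]; rewrite -bigcup_seq => -[i _ [B mB <-]].
rewrite !setTI (_ : _ @^-1` _ = (fun t : n.-tuple R => tnth t i) @^-1` B).
  by rewrite -[X in measurable X]setTI; exact: measurable_tnth.
by apply/seteqP; split => t /=; rewrite mxE.
Qed.

Section tuple_step.
Context n (mu : {sigma_finite_measure set (n.-tuple R) -> \bar R}).

Definition tuple_step : set (n.+1.-tuple R) -> \bar R :=
  pushforward (@lebesgue_measure R \x mu)%E (@tcons n).

HB.instance Definition _ := Measure.copy tuple_step
  (measure_function_pushforward__canonical__measure_function_Measure
    (@lebesgue_measure R \x mu)%E (@measurable_tcons n)).

Let tuple_step_sigma_finite : sigma_finite setT tuple_step.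
Proof.
have [F FT mF] : sigma_finite setT (@lebesgue_measure R \x mu)%E.
  exact: sigma_finite_prod.
pose u (t : n.+1.-tuple R) := (thead t, [tuple of behead t]).
have mu_ : measurable_fun setT u.
  apply: measurable_fun_pair; first exact: measurable_tnth.
  exact: measurable_behead.
have uK p : u (tcons p) = p.
  by case: p => x t; congr pair; apply/val_inj.
exists (fun i => u @^-1` F i).
  by rewrite -preimage_bigcup -FT preimage_setT.
move=> i; have [mFi Fioo] := mF i; split.
  by rewrite -[X in measurable X]setTI; exact: mu_.
rewrite /tuple_step /pushforward -comp_preimage.
by rewrite (_ : u \o _ = id)//; apply/funext => p /=; rewrite uK.
Qed.

HB.instance Definition _ := @Measure_isSigmaFinite.Build _ _ _ tuple_step
  tuple_step_sigma_finite.

End tuple_step.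

Fixpoint lebesgue_tuple n : {sigma_finite_measure set (n.-tuple R) -> \bar R} :=
  match n with
  | 0 => \d_([tuple])
  | n'.+1 => tuple_step (lebesgue_tuple n')
  end.

Definition lebesgue_Rn n : set 'rV[R]_n -> \bar R :=
  pushforward (lebesgue_tuple n) (@tuple_row n).

HB.instance Definition _ n := Measure.copy (@lebesgue_Rn n)
  (measure_function_pushforward__canonical__measure_function_Measure
    (lebesgue_tuple n) (@measurable_tuple_row n)).

End lebesgue_Rn.
Arguments lebesgue_Rn {R} n.

Section complex_valued.
Context {R : realType}.

Definition cabs (z : R[i]) : R := Num.sqrt (complex.Re z ^+ 2 + complex.Im z ^+ 2).

(* exp (2 pi i t) *)
Definition cis2pi (t : R) : R[i] :=
  Complex (cos (2 * pi * t)) (sin (2 * pi * t)).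

Definition Cmeasurable d (T : measurableType d) (h : T -> R[i]) : Prop :=
  measurable_fun [set: T] (fun y => complex.Re (h y)) /\
  measurable_fun [set: T] (fun y => complex.Im (h y)).

Definition Cintegral d (T : measurableType d) (mu : {measure set T -> \bar R})
    (D : set T) (h : T -> R[i]) : R[i] :=
  Complex (\int[mu]_(y in D) complex.Re (h y)) (\int[mu]_(y in D) complex.Im (h y)).

Definition Clim (u : nat -> R[i]) : R[i] :=
  Complex (lim (complex.Re (u n) @[n --> \oo])) (lim (complex.Im (u n) @[n --> \oo])).

End complex_valued.

Section univariate.
Context {R : realType}.
Implicit Types (f psi : R -> R).

Definition unit_itv : set R := `]- 2^-1, 2^-1[%classic.

(* A transformation is a total function R -> R of which only the values on
   unit_itv matter. *)
Definition is_transformation psi : Prop :=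
  [/\ {in unit_itv, forall x, derivable psi x 1} /\
        {in unit_itv, continuous (derive1 psi)},
      {in unit_itv &, {homo psi : x y / x < y}},
      {in unit_itv, forall x, psi (- x) = - psi x},
      psi x @[x --> (- 2^-1)^'+] --> -oo &
      psi x @[x --> (2^-1)^'-] --> +oo].

Definition transformation_inv psi (y : R) : R :=
  xget 0 [set x | unit_itv x /\ psi x = y].

Definition density psi : R -> R := derive1 (transformation_inv psi).

Definition is_weight f : Prop :=
  measurable_fun [set: R] f /\ forall y, 0 <= f y.

Definition derivable_upto (m : nat) (A : set R) f : Prop :=
  forall j, (j < m)%N -> {in A, forall x, derivable (derive1n j f) x 1}.

Definition C0 f : Prop :=
  [/\ continuous f, f y @[y --> +oo] --> 0 & f y @[y --> -oo] --> 0].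

(* the L_oo norm on the torus of a function defined on unit_itv *)
Definition Linfty_torus f : \bar R :=
  ess_sup (@lebesgue_measure R) ((fun x => `|f x|%:E) \_ unit_itv).

(* x |-> sqrt (omega (psi x) * psi' x) *)
Definition transformed_weight (om psi : R -> R) (x : R) : R :=
  Num.sqrt (om (psi x) * derive1 psi x).

End univariate.

Section multivariate.
Context {R : realType} {d : nat}.
Local Notation Rd := 'rV[R]_d.
Local Notation Zd := 'rV[int]_d.
Local Notation leb := (@lebesgue_Rn R d).

Definition L2 (h : Rd -> R[i]) : Prop :=
  Cmeasurable h /\ (\int[leb]_y (cabs (h y) ^+ 2)%:E < +oo)%E.

Definition L2_weighted (w : Rd -> R) (h : Rd -> R[i]) : Prop :=
  L2 h /\ (\int[leb]_y (cabs (h y) ^+ 2 * w y)%:E < +oo)%E.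

Definition partial (i : 'I_d) (f : Rd -> R) : Rd -> R :=
  fun x => 'D_(delta_mx ord0 i) f x.

Definition mixed_partial (a : 'I_d -> nat) (f : Rd -> R) : Rd -> R :=
  foldr (fun i g => iter (a i) (partial i) g) f (enum 'I_d).

(* C^oo with compact support *)
Definition test_function (f : Rd -> R) : Prop :=
  (forall s : seq 'I_d, let g := foldr partial f s in
     continuous g /\ forall i x, derivable g x (delta_mx ord0 i)) /\
  compact (closure [set x | f x != 0]).

Definition weak_partial (a : 'I_d -> nat) (h g : Rd -> R[i]) : Prop :=
  forall f, test_function f ->
    Cintegral leb setT (fun y => h y * (mixed_partial a f y)%:C%C) =
    (-1) ^+ (\sum_i a i)%N * Cintegral leb setT (fun y => g y * (f y)%:C%C).

(* {ffun 'I_d -> 'I_m.+1} is the set of multi-indices with entries <= m *)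
Definition Hmix (m : nat) (h : Rd -> R[i]) : Prop :=
  L2 h /\
  exists D : {ffun 'I_d -> 'I_m.+1} -> Rd -> R[i],
    (forall a, Cmeasurable (D a) /\ weak_partial (fun i => a i) h (D a)) /\
    (\sum_a \int[leb]_y (cabs (D a y) ^+ 2)%:E < +oo)%E.

Definition mtransform (psi : 'I_d -> R -> R) (x : Rd) : Rd :=
  \row_i psi i (x ord0 i).

Definition mtransform_inv (psi : 'I_d -> R -> R) (y : Rd) : Rd :=
  \row_i transformation_inv (psi i) (y ord0 i).

Definition mtransform_deriv (psi : 'I_d -> R -> R) (x : Rd) : R :=
  \prod_i derive1 (psi i) (x ord0 i).

Definition mdensity (psi : 'I_d -> R -> R) (y : Rd) : R :=
  \prod_i density (psi i) (y ord0 i).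

Definition mweight (om : 'I_d -> R -> R) (y : Rd) : R :=
  \prod_i om i (y ord0 i).

Definition omega_hc (k : Zd) : nat := \prod_i maxn 1 `|k ord0 i|%N.

Definition hyperbolic_cross (N : nat) : set Zd :=
  [set k | (omega_hc k <= N)%N].

Definition zdot (k : Zd) (x : Rd) : R := \sum_i (k ord0 i)%:~R * x ord0 i.

(* representative of x mod 1 in [-1/2, 1/2)^d *)
Definition mod1 (x : Rd) : Rd :=
  \row_i (x ord0 i - (Num.floor (x ord0 i + 2^-1))%:~R).

Definition lattice_point (z : Zd) (M j : nat) : Rd :=
  mod1 (\row_i (j%:R / M%:R * (z ord0 i)%:~R)).

Definition reconstructing (z : Zd) (M : nat) (I : set Zd) : Prop :=
  forall k1 k2, I k1 -> I k2 -> k1 - k2 != 0 ->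
    ~~ (M%:Z %| \sum_i (k1 - k2) ord0 i * z ord0 i)%Z.

Section transformed.
Variables (psi om : 'I_d -> R -> R).

Definition phi (k : Zd) (y : Rd) : R[i] :=
  (Num.sqrt (mdensity psi y / mweight om y))%:C%C *
  cis2pi (zdot k (mtransform_inv psi y)).

Definition fourier_coef (h : Rd -> R[i]) (k : Zd) : R[i] :=
  Cintegral leb setT
    (fun y => h y * conjc (phi k y) * (mweight om y)%:C%C).

Definition Hm_norm (m : nat) (h : Rd -> R[i]) : \bar R :=
  ((\esum_(k in [set: Zd])
     ((omega_hc k)%:R ^+ (2 * m) * cabs (fourier_coef h k) ^+ 2)%:E)
   `^ 2^-1)%E.

(* the transformed function on the open cube (-1/2, 1/2)^d *)
Definition transformed (h : Rd -> R[i]) (x : Rd) : R[i] :=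
  h (mtransform psi x) *
  (Num.sqrt (mweight om (mtransform psi x) * mtransform_deriv psi x))%:C%C.

Definition torus_coef (f : Rd -> R[i]) (k : Zd) : R[i] :=
  Cintegral leb [set x | forall i, unit_itv (x ord0 i)]
    (fun x => f x * cis2pi (- zdot k x)).

(* The continuous representative of an f with absolutely summable Fourier
   coefficients, as the limit of the cubic partial sums of its Fourier series;
   it is also defined at points of the boundary of the cube. *)
Definition fourier_representative (f : Rd -> R[i]) (x : Rd) : R[i] :=
  Clim (fun n => \sum_(k \in [set k : Zd | forall i, (`|k ord0 i| <= n)%N])
    torus_coef f k * cis2pi (zdot k x)).

(* Fourier coefficients approximated by sampling the continuous
   representative of the transformed function at the lattice points *)
Definition approx_coef (z : Zd) (M : nat) (h : Rd -> R[i]) (k : Zd) : R[i] :=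
  (M%:R)^-1 * \sum_(j < M)
    fourier_representative (transformed h) (lattice_point z M j) *
    cis2pi (- zdot k (lattice_point z M j)).

Definition approx_sum (z : Zd) (M : nat) (I : set Zd) (h : Rd -> R[i])
    (y : Rd) : R[i] :=
  \sum_(k \in I) approx_coef z M h k * phi k y.

Definition Linfty_weighted (g : Rd -> R[i]) : \bar R :=
  ess_sup leb
    (fun y => (Num.sqrt (mweight om y / mdensity psi y) * cabs (g y))%:E).

End transformed.
End multivariate.

(* Main.v *)
Require Import Defs.
From HB Require Import structures.
From mathcomp Require Import all_boot all_order all_algebra.
From mathcomp Require Import all_classical all_reals all_analysis.
From mathcomp Require Import measurable_realfun ess_sup_inf complex ring lra zify.

Set Implicit Arguments.
Unset Strict Implicit.
Unset Printing Implicit Defensive.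

Import Order.TTheory GRing.Theory Num.Theory.
Import numFieldTopology.Exports numFieldNormedType.Exports.

Local Open Scope classical_set_scope.
Local Open Scope ring_scope.

(** Why the estimate holds.

    If the norm of h in H^m is infinite there is nothing to prove.  Otherwise
    let c k be the Fourier coefficients of h.  As m >= 1, the Cauchy-Schwarz
    inequality with the weights omega_hc^-m and omega_hc^m makes them absolutely
    summable, so that their Fourier series F converges everywhere.  The change
    of variables y = psi x shows that the transformed function on the cube has
    the same coefficients (torus_coefE); hence F is the function that is
    sampled, and h * sqrt (omega / rho) agrees almost everywhere with F composed
    with the inverse of psi (fourier_expansion).  The weighted error at almost
    every y is therefore the error, at a point x, of the lattice approximation
    of F by trigonometric polynomials.

    That error is bounded frequency by frequency.  By the reconstruction
    property the lattice rule reproduces exp (2 pi i l.x) when l is in the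
    hyperbolic cross, and otherwise replaces it by zero or by exactly one alias
    in the cross; so each l outside the cross costs at most 2 |c l|
    (aliasing_error, sampling_error, fourier_sum_sampling_error).  The sum of
    |c l| outside the cross is estimated by Cauchy-Schwarz once more: there, if
    lambda <= m, as may be assumed, omega_hc^(-2m) is at most
    N^(-2m + 2 lambda) omega_hc^(-2 lambda), and the sum of omega_hc^(-2 lambda)
    over all frequencies is a product of convergent series because 2 lambda > 1
    (hyperbolic_tail).

    Two facts carry the identification of h with its Fourier series.  First,
    the density of psi being continuous, psi' cannot vanish
    (transformation_deriv_neq0); so rho = 1 / psi' o psi^-1 is positive, and the
    image of Lebesgue measure on the cube under psi has density rho
    (ge0_integral_transformation in one variable, ge0_integral_row_map in
    several).  Second, an integrable function on R^n orthogonal to all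
    characters of the torus, read through psi^-1, vanishes almost everywhere
    (trigonometric_uniqueness).  The constant of the estimate depends only on d,
    m and lambda. *)

(** * Univariate transformations *)

Section integral_density_measure.
Local Open Scope ereal_scope.
Context d (T : measurableType d) {R : realType}.
Variables (mu nu : {measure set T -> \bar R}) (w : T -> R).
Hypothesis mw : measurable_fun [set: T] w.
Hypothesis w0 : forall x, (0 <= w x)%R.
Hypothesis nuE : forall A, measurable A -> nu A = \int[mu]_(x in A) (w x)%:E.

Import HBNNSimple.

Let mwE : measurable_fun [set: T] (fun x => (w x)%:E).
Proof. exact/measurable_EFinP. Qed.

Let integral_density_nnsfun (g : {nnsfun T >-> R}) :
  \int[nu]_x (g x)%:E = \int[mu]_x ((g x)%:E * (w x)%:E).
Proof.
under eq_integral do rewrite fimfunE -fsumEFin//.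
under [RHS]eq_integral => x _.
  rewrite fimfunE -fsumEFin// ge0_mule_fsuml; last first.
    by move=> r; rewrite nnfun_muleindic_ge0.
  over.
have mi r : measurable_fun [set: T] (fun x : T => (r * \1_(g @^-1` [set r]) x)%:E).
  by apply/measurable_EFinP; exact: measurable_funM.
rewrite !ge0_integral_fsum//.
- apply: eq_fsbigr => r rg.
  have r0 : (0 <= r)%R by move: rg; rewrite inE => -[x _ <-].
  under eq_integral do rewrite EFinM.
  under [RHS]eq_integral do rewrite EFinM -muleA.
  rewrite !ge0_integralZl//.
  + congr (_ * _); rewrite integral_indic// setIT nuE// integral_mkcond.
    by apply: eq_integral => x _; rewrite epatch_indic muleC.
  + by apply: emeasurable_funM => //; exact/measurable_EFinP.
  + by move=> x _; rewrite mule_ge0// lee_fin.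
  + exact/measurable_EFinP.
- by move=> r; apply: emeasurable_funM.
- move=> r x _; apply: mule_ge0; [exact: nnfun_muleindic_ge0|].
  by rewrite lee_fin.
- by move=> r x _; rewrite nnfun_muleindic_ge0.
Qed.

(** Both sides are limits along the same increasing simple functions, for which
    they agree by the hypothesis on nu. *)
Lemma ge0_integral_density (f : T -> \bar R) : measurable_fun [set: T] f ->
  (forall x, 0 <= f x) -> \int[nu]_x f x = \int[mu]_x (f x * (w x)%:E).
Proof.
move=> mf f0; pose h := nnsfun_approx measurableT mf.
have hf x : (EFin \o h ^~ x) n @[n --> \oo] --> f x by exact: cvg_nnsfun_approx.
transitivity (limn (fun n => \int[nu]_x (h n x)%:E)).
  rewrite -monotone_convergence//.
  - by apply: eq_integral => x _; apply/esym/cvg_lim => //; exact: hf.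
  - by move=> n; exact/measurable_EFinP.
  - by move=> n x _; rewrite lee_fin.
  - by move=> x _ a b ab; rewrite lee_fin; exact/lefP/nd_nnsfun_approx.
under eq_fun do rewrite integral_density_nnsfun.
rewrite -monotone_convergence//.
- apply: eq_integral => x _; apply/cvg_lim => //.
  by apply: cvgeZr => //; exact: hf.
- by move=> n; apply: emeasurable_funM => //; exact/measurable_EFinP.
- by move=> n x _; rewrite mule_ge0// lee_fin.
- move=> x _ a b ab; apply: lee_wpmul2r; first by rewrite lee_fin.
  by rewrite lee_fin; exact/lefP/nd_nnsfun_approx.
Qed.

End integral_density_measure.

Section transformation_facts.
Context {R : realType}.
Variable psi : R -> R.
Hypothesis psiT : is_transformation psi.
Local Notation U := (@unit_itv R).
Local Notation xi := (transformation_inv psi).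

Lemma unit_itvE (x : R) : U x = (- 2^-1 < x < 2^-1) :> Prop.
Proof. by rewrite /unit_itv /= in_itv. Qed.

Lemma nbhs_unit_itv (x : R) : U x -> \forall z \near x, U z.
Proof. by move=> Ux; apply: open_nbhs_nbhs; split => //; exact: interval_open. Qed.

Lemma transformation_is_derive x : U x -> is_derive x 1 psi (derive1 psi x).
Proof.
move=> Ux; have [[dpsi _] _ _ _ _] := psiT.
by rewrite derive1E; apply: DeriveDef => //; apply: dpsi; exact: mem_set.
Qed.

Lemma transformation_continuous x : U x -> {for x, continuous psi}.
Proof.
move=> Ux; have [[dpsi _] _ _ _ _] := psiT.
by apply: differentiable_continuous; apply/derivable1_diffP/dpsi; exact: mem_set.
Qed.

Lemma transformation_lt x y : U x -> U y -> (psi x < psi y) = (x < y).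
Proof.
move=> Ux Uy; have [_ homo _ _ _] := psiT.
apply/idP/idP => [|xy]; last by apply: homo => //; exact: mem_set.
apply: contraTT; rewrite -!leNgt le_eqVlt => /predU1P[->//|yx].
by apply/ltW/homo => //; exact: mem_set.
Qed.

Lemma transformation_surjective y : exists2 x, U x & psi x = y.
Proof.
have [_ _ _ psiNy psiy] := psiT.
have [a [Ua ay]] : exists a, U a /\ psi a < y.
  near (- 2^-1 : R)^'+ => a; exists a; split.
    by rewrite unit_itvE; apply/andP; split; near: a;
      [exact: nbhs_right_gt|apply: nbhs_right_lt; lra].
  by near: a; move/cvgrNyPlt : psiNy; apply; exact: num_real.
have [b [Ub yb]] : exists b, U b /\ y < psi b.
  near (2^-1 : R)^'- => b; exists b; split.
    by rewrite unit_itvE; apply/andP; split; near: b;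
      [apply: nbhs_left_gt; lra|exact: nbhs_left_lt].
  by near: b; move/cvgryPgt : psiy; apply; exact: num_real.
have ab : a < b by rewrite -transformation_lt// (lt_trans ay).
have sub x : x \in `[a, b] -> U x.
  rewrite in_itv/= => /andP[ax xb]; move: Ua Ub; rewrite !unit_itvE.
  by move=> /andP[? ?] /andP[? ?]; apply/andP; split; lra.
have [] := @IVT R psi a b y (ltW ab).
- apply: continuous_in_subspaceT => x; rewrite inE => xab.
  exact/transformation_continuous/sub.
- by rewrite min_l ?max_r ?(ltW (lt_trans ay yb))// (ltW ay) (ltW yb).
by move=> c cab <-; exists c => //; exact: sub.
Unshelve. all: by end_near. Qed.

Lemma transformation_invP y : U (xi y) /\ psi (xi y) = y.
Proof.
rewrite /transformation_inv; case: xgetP => [x _ //|none].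
by have [x Ux yE] := transformation_surjective y; case: (none x).
Qed.

Lemma transformation_inv_unit y : U (xi y).
Proof. by have [] := transformation_invP y. Qed.

Lemma transformation_invK y : psi (xi y) = y.
Proof. by have [] := transformation_invP y. Qed.

Lemma transformation_inv_lt y z : (xi y < xi z) = (y < z).
Proof.
by rewrite -transformation_lt ?transformation_invK//;
  exact: transformation_inv_unit.
Qed.

Lemma transformationK x : U x -> xi (psi x) = x.
Proof.
move=> Ux; have Uxi := transformation_inv_unit (psi x).
by apply/eqP; rewrite eq_le !leNgt -(transformation_lt Uxi Ux)
  -(transformation_lt Ux Uxi) transformation_invK ltxx.
Qed.

Lemma transformation_inv_is_derive_image x : U x -> derive1 psi x != 0 ->
  is_derive (psi x) 1 xi (derive1 psi x)^-1.
Proof.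
move=> Ux dx0; apply: is_derive_inverse => //; last exact: transformation_is_derive.
- by apply: filterS (nbhs_unit_itv Ux) => z; exact: transformationK.
- by apply: filterS (nbhs_unit_itv Ux) => z; exact: transformation_continuous.
Qed.

Hypothesis rhoC : continuous (density psi).

(** At a critical point of psi, the points nearby at which psi' does not vanish
    have images at which the density is arbitrarily large; a locally bounded
    density thus makes psi' vanish, and psi constant, around that point. *)
Lemma transformation_deriv_neq0 x : U x -> derive1 psi x != 0.
Proof.
move=> Ux; apply/negP => /eqP dx0.
have [[_ dpsiC] _ _ _ _] := psiT.
pose B := `|density psi (psi x)| + 1.
have B0 : 0 < B by rewrite /B ltr_wpDl.
have nearB : \forall z \near x, `|density psi (psi z)| < B.
  have : {for x, continuous (density psi \o psi)}.
    by apply: continuous_comp; [exact: transformation_continuous|exact: rhoC].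
  move=> /cvg_norm /= /cvgr_lt; apply.
  by rewrite /B ltrDl.
have near0 : \forall z \near x, derive1 psi z = 0.
  have dB : \forall z \near x, `|derive1 psi z| < B^-1.
    have := dpsiC x (mem_set Ux).
    move=> /cvg_norm /= /cvgr_lt; apply.
    by rewrite dx0 normr0 invr_gt0.
  near=> z; apply/eqP; apply: contraPT (near nearB z _) => // dz0.
  have Uz : U z by near: z; exact: nbhs_unit_itv.
  have dz := transformation_inv_is_derive_image Uz dz0.
  apply/negP; rewrite -leNgt /density derive1E (@derive_val _ _ _ _ _ _ _ dz).
  rewrite normfV -[leLHS]invrK lef_pV2 ?posrE ?normr_gt0 ?invr_gt0//.
  by apply: ltW; near: z.
have /nbhs_ballP[e /= e0 be] : nbhs x (fun z => derive1 psi z = 0 /\ U z).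
  by apply: filterI => //; exact: nbhs_unit_itv.
have bz z : x <= z <= x + e / 2 -> ball x e z.
  by move=> /andP[? ?]; rewrite /ball/= ler0_norm ?subr_le0//; lra.
have [] := @MVT _ psi (derive1 psi) x (x + e / 2).
- by rewrite ltrDl divr_gt0.
- move=> z; rewrite in_itv/= => /andP[xz ze]; apply: transformation_is_derive.
  by have [] := be z; first by apply: bz; rewrite !ltW.
- apply: continuous_in_subspaceT => z; rewrite inE/= in_itv/= => zx.
  by apply: transformation_continuous; have [] := be z; first exact: bz.
move=> c; rewrite in_itv/= => /andP[xc ce].
have [] := be c; first by apply: bz; rewrite !ltW.
move=> -> _; rewrite mul0r => /eqP; rewrite subr_eq0 => /eqP psiE.
have [_ Ue] : derive1 psi (x + e / 2) = 0 /\ U (x + e / 2).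
  by apply: be; apply: bz; rewrite lexx andbT lerDl divr_ge0// ltW.
by have := transformation_lt Ux Ue; rewrite psiE ltxx ltrDl divr_gt0.
Unshelve. all: by end_near. Qed.

Lemma transformation_deriv_gt0 x : U x -> 0 < derive1 psi x.
Proof.
move=> Ux; rewrite lt_neqAle eq_sym transformation_deriv_neq0//=.
have [[dpsi _] homo _ _ _] := psiT.
apply: (@incr_derive1_ge0_itv _ psi false true (- 2^-1) (2^-1)).
- by move=> z zU; apply: dpsi.
- by move=> a b aU bU ab; apply: homo => //; exact: mem_set.
- exact: Ux.
Qed.

Lemma transformation_inv_is_derive (y : R) : is_derive y 1 xi (density psi y).
Proof.
have [Ux yE] := transformation_invP y; rewrite -{1 2}yE.
have dxi := transformation_inv_is_derive_image Ux (transformation_deriv_neq0 Ux).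
by rewrite /density derive1E (@derive_val _ _ _ _ _ _ _ dxi).
Qed.

Lemma densityE x : U x -> density psi (psi x) = (derive1 psi x)^-1.
Proof.
move=> Ux; have dxi := transformation_inv_is_derive_image Ux (transformation_deriv_neq0 Ux).
by rewrite /density derive1E (@derive_val _ _ _ _ _ _ _ dxi).
Qed.

Lemma density_gt0 y : 0 < density psi y.
Proof.
have [Ux {1}<-] := transformation_invP y.
by rewrite densityE// invr_gt0 transformation_deriv_gt0.
Qed.

Lemma transformation_inv_continuous : continuous xi.
Proof.
move=> y; apply: differentiable_continuous; apply/derivable1_diffP.
by have := transformation_inv_is_derive y; case.
Qed.

Lemma integral_density a b : a < b ->
  (\int[lebesgue_measure]_(y in `]a, b]) (density psi y)%:E
   = (xi b - xi a)%:E)%E.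
Proof.
move=> ab; rewrite integral_itv_obnd_cbnd; last first.
  by apply/measurable_EFinP/measurable_funTS; exact: continuous_measurable_fun.
rewrite (@continuous_FTC2 _ _ xi)//.
- exact: continuous_subspaceT.
- split.
  + by move=> y _; have := transformation_inv_is_derive y; case.
  + exact/cvg_at_right_filter/transformation_inv_continuous.
  + exact/cvg_at_left_filter/transformation_inv_continuous.
Qed.

End transformation_facts.

Section transformation_change_of_variables.
Context {R : realType}.
Variable psi : R -> R.
Hypotheses (psiT : is_transformation psi) (rhoC : continuous (density psi)).
Local Notation U := (@unit_itv R).
Local Notation leb := (@lebesgue_measure R).

Lemma measurable_unit_itv : measurable U.
Proof. exact: measurable_itv. Qed.

(** psi extended by 0, so as to be measurable on the whole line *)
Definition transformation_ext : R -> R := psi \_ U.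

Lemma measurable_transformation_ext :
  measurable_fun [set: measurableTypeR R]
    (transformation_ext : measurableTypeR R -> measurableTypeR R).
Proof.
apply/(measurable_restrictT _ measurable_unit_itv).
apply: open_continuous_measurable_fun; first exact: interval_open.
by move=> x; rewrite inE => Ux; exact: transformation_continuous.
Qed.

Lemma measurable_density : measurable_fun [set: R] (density psi).
Proof. exact: continuous_measurable_fun. Qed.

Definition image_measure : set (measurableTypeR R) -> \bar R :=
  pushforward (mrestr leb measurable_unit_itv)
    (transformation_ext : measurableTypeR R -> measurableTypeR R).

HB.instance Definition _ := Measure.copy image_measure
  (measure_function_pushforward__canonical__measure_function_Measure
    (mrestr leb measurable_unit_itv) measurable_transformation_ext).

Definition density_measure (A : set (measurableTypeR R)) : \bar R :=
  (\int[leb]_(y in A) (density psi y)%:E)%E.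

Let density_measure0 : density_measure set0 = 0%E.
Proof. exact: integral_set0. Qed.

Let density_measure_ge0 A : (0 <= density_measure A)%E.
Proof.
by apply: integral_ge0 => y _; rewrite lee_fin; apply/ltW/density_gt0.
Qed.

Let density_measure_sigma_additive : semi_sigma_additive density_measure.
Proof.
apply: (@semi_sigma_additive_nng_induced _ (measurableTypeR R) R leb
    (fun y => (density psi y)%:E)).
  by apply/measurable_EFinP; exact: measurable_density.
by move=> y; rewrite lee_fin; apply/ltW/density_gt0.
Qed.

HB.instance Definition _ := isMeasure.Build _ _ _ density_measure
  density_measure0 density_measure_ge0 density_measure_sigma_additive.

Let image_measure_itv a b : a < b ->
  image_measure `]a, b] = (transformation_inv psi b - transformation_inv psi a)%:E.
Proof.
move=> ab; have xiab := ab; rewrite -(transformation_inv_lt psiT) in xiab.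
rewrite /image_measure /pushforward /mrestr.
rewrite (_ : _ `&` _ = `]transformation_inv psi a, transformation_inv psi b]%classic).
  by rewrite lebesgue_measure_itv/= lte_fin xiab.
have psi_lt := transformation_lt psiT.
have Ua := transformation_inv_unit psiT a.
have Ub := transformation_inv_unit psiT b.
apply/seteqP; split => [x [+ Ux]|x].
  rewrite /= /transformation_ext patchE mem_set// !in_itv/=.
  rewrite -{1}(transformation_invK psiT a) psi_lt// => /andP[-> /=].
  by rewrite !leNgt -{1}(transformation_invK psiT b) psi_lt.
rewrite /= in_itv/= => /andP[ax xb].
have Ux : U x.
  move: Ua Ub; rewrite !unit_itvE => /andP[? _] /andP[_ ?].
  by rewrite (lt_trans _ ax)// (le_lt_trans xb).
split => //; rewrite /= /transformation_ext patchE mem_set// in_itv/=.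
rewrite -{1}(transformation_invK psiT a) psi_lt// ax/=.
by rewrite leNgt -{1}(transformation_invK psiT b) psi_lt// -leNgt.
Qed.

Let image_measureE (A : set (measurableTypeR R)) : measurable A ->
  image_measure A = density_measure A.
Proof.
refine (@measure_unique _ R (measurableTypeR R) (@ocitv R)
    (fun n => `]- n%:R, n%:R]%classic) _ _ _ _ image_measure density_measure _ _ A) => //.
- exact: ocitvI.
- by move=> n; exact: is_ocitv.
- by rewrite bigcup_itvT.
- move=> _ /ocitvP[->|[[a b] /= ab ->]]; first by rewrite !measure0.
  by rewrite [LHS]image_measure_itv// [RHS]integral_density.
- move=> n; case: n => [|n].
    by rewrite set_itv_ge ?measure0// bnd_simp oppr0 ltxx.
  by rewrite [X in (X < _)%E]image_measure_itv ?ltry// gtrN.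
Qed.

(** The image of Lebesgue measure on the unit interval under psi has the density
    of psi; this identity of measures is read off the intervals ]a, b], on
    which both sides are the increment of the inverse of psi. *)
Lemma ge0_integral_transformation (G : R -> \bar R) :
  measurable_fun [set: R] G -> (forall y, (0 <= G y)%E) ->
  (\int[leb]_(x in U) G (psi x) = \int[leb]_y (G y * (density psi y)%:E))%E.
Proof.
move=> mG G0.
rewrite -(@ge0_integral_density _ (measurableTypeR R) _ leb image_measure (density psi)
  measurable_density (fun y => ltW (density_gt0 psiT rhoC y)) image_measureE)//.
transitivity (\int[mrestr leb measurable_unit_itv]_x G (transformation_ext x))%E;
  last first.
  have := @ge0_integral_pushforward _ _ _ _ R _
    measurable_transformation_ext (mrestr leb measurable_unit_itv) setT G
    measurableT mG (fun y _ => G0 y).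
  by rewrite preimage_setT => <-.
rewrite (@ge0_integral_density _ (measurableTypeR R) _ leb _ (\1_U : R -> R))//.
- rewrite [LHS]integral_mkcond; apply: eq_integral => x _.
  rewrite patchE indicE /transformation_ext patchE.
  by case: ifPn => // Ux; rewrite ?mule1 ?mule0.
- by apply: measurable_indic; exact: measurable_unit_itv.
- move=> A mA; rewrite integral_indic//; last exact: measurable_unit_itv.
  by rewrite /= /mrestr setIC.
- by apply: measurableT_comp => //; exact: measurable_transformation_ext.
Qed.

End transformation_change_of_variables.

(** * Lebesgue measure on R^n, coordinate by coordinate *)

Section lebesgue_Rn_recursion.
Context {R : realType}.
Local Open Scope ereal_scope.

Lemma measurable_row_coord n (i : 'I_n) :
  measurable_fun [set: 'rV[R]_n] (fun v : 'rV[R]_n => v ord0 i).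
Proof.
move=> _ B mB; rewrite setTI; apply: sub_sigma_algebra.
rewrite -bigcup_seq; exists i; first by rewrite /= mem_index_enum.
by exists B => //; rewrite setTI.
Qed.

(** The sigma-algebra of R^n is generated by the coordinates. *)
Lemma measurable_rowP d (T : measurableType d) n (f : T -> 'rV[R]_n) :
  (forall i, measurable_fun [set: T] (fun t => f t ord0 i)) ->
  measurable_fun [set: T] f.
Proof.
move=> mf; apply: (measurability (\big[setU/set0]_(i < n)
  preimage_set_system setT (fun v : 'rV[R]_n => v ord0 i) measurable)).
  by [].
move=> _ [A + <-]; rewrite -bigcup_seq => -[i _ [B mB <-]].
by rewrite setTI; exact: mf.
Qed.

Definition row_cons n (x : R) (v : 'rV[R]_n) : 'rV[R]_n.+1 :=
  \row_i oapp (v ord0) x (unlift ord0 i).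

Lemma row_cons0 n x (v : 'rV[R]_n) : row_cons x v ord0 ord0 = x.
Proof. by rewrite mxE unlift_none. Qed.

Lemma row_consS n x (v : 'rV[R]_n) i : row_cons x v ord0 (lift ord0 i) = v ord0 i.
Proof. by rewrite mxE liftK. Qed.

Lemma measurable_row_cons n : measurable_fun [set: R * 'rV[R]_n]
  (fun p : R * 'rV[R]_n => row_cons p.1 p.2).
Proof.
apply: measurable_rowP => i; case: (unliftP ord0 i) => [j ->|->].
  under eq_fun do rewrite row_consS.
  by apply: (measurableT_comp (measurable_row_coord j)); exact: measurable_snd.
by under eq_fun do rewrite row_cons0; exact: measurable_fst.
Qed.

Lemma measurable_row_cons2 n x :
  measurable_fun [set: 'rV[R]_n] (@row_cons n x).
Proof.
apply: measurable_rowP => i; case: (unliftP ord0 i) => [j ->|->].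
  by under eq_fun do rewrite row_consS; exact: measurable_row_coord.
by under eq_fun do rewrite row_cons0; exact: measurable_cst.
Qed.

Lemma tuple_row_tcons n (x : R) (t : n.-tuple R) :
  tuple_row (tcons (x, t)) = row_cons x (tuple_row t).
Proof.
apply/rowP => i; rewrite !mxE; case: (unliftP ord0 i) => [j ->|->] /=.
  by rewrite mxE tnthS.
by rewrite tnth0.
Qed.

Lemma ge0_integral_Rn_tuple n (G : 'rV[R]_n -> \bar R) :
  measurable_fun [set: 'rV[R]_n] G -> (forall v, 0 <= G v) ->
  \int[lebesgue_Rn n]_v G v = \int[lebesgue_tuple R n]_t G (tuple_row t).
Proof.
move=> mG G0.
have := @ge0_integral_pushforward _ _ _ _ R _ (@measurable_tuple_row R n)
  (lebesgue_tuple R n) setT G measurableT mG (fun y _ => G0 y).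
by rewrite preimage_setT.
Qed.

Lemma integral_Rn0 (G : 'rV[R]_0 -> \bar R) :
  measurable_fun [set: 'rV[R]_0] G -> (forall v, 0 <= G v) ->
  \int[lebesgue_Rn 0]_v G v = G 0%R.
Proof.
move=> mG G0; rewrite ge0_integral_Rn_tuple// integral_dirac//.
- by rewrite diracT mul1e; congr G; apply/rowP; case.
- apply: (measurableT_comp mG); exact: measurable_tuple_row.
Qed.

Section step.
Context n (G : 'rV[R]_n.+1 -> \bar R).
Hypotheses (mG : measurable_fun [set: 'rV[R]_n.+1] G) (G0 : forall v, 0 <= G v).

Let mGx x : measurable_fun [set: 'rV[R]_n] (G \o row_cons x).
Proof. exact: (measurableT_comp mG (@measurable_row_cons2 n x)). Qed.

Let mGt : measurable_fun [set: R * n.-tuple R]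
  (fun p : R * n.-tuple R => G (row_cons p.1 (tuple_row p.2))).
Proof.
have mpair : measurable_fun [set: R * n.-tuple R]
    (fun p : R * n.-tuple R => (p.1, tuple_row p.2)).
  apply: measurable_fun_pair; first exact: measurable_fst.
  exact: (measurableT_comp (@measurable_tuple_row R n)).
exact: (measurableT_comp mG (measurableT_comp (@measurable_row_cons n) mpair)).
Qed.

(** Tonelli's theorem, one coordinate at a time: the recursion that carries the
    inductions on the dimension. *)
Lemma ge0_integral_RnS : \int[lebesgue_Rn n.+1]_v G v =
  \int[lebesgue_measure]_x \int[lebesgue_Rn n]_v G (row_cons x v).
Proof.
rewrite ge0_integral_Rn_tuple//.
have := @ge0_integral_pushforward _ _ (measurableTypeR R * n.-tuple R)%type
  (n.+1.-tuple R) R (@tcons R n) (@measurable_tcons R n)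
  (lebesgue_measure \x lebesgue_tuple R n)%E setT (G \o @tuple_row R n.+1)
  measurableT (measurableT_comp mG (@measurable_tuple_row R n.+1))
  (fun y _ => G0 _).
rewrite preimage_setT => E; rewrite [LHS]E {E}.
transitivity (\int[lebesgue_measure \x lebesgue_tuple R n]_p
    G (row_cons p.1 (tuple_row p.2))).
  by apply: eq_integral => -[x t] _ /=; rewrite tuple_row_tcons.
rewrite fubini_tonelli1//; apply: eq_integral => x _.
by rewrite ge0_integral_Rn_tuple//; exact: mGx.
Qed.

Lemma measurable_integral_RnS : measurable_fun [set: R]
  (fun x => \int[lebesgue_Rn n]_v G (row_cons x v)).
Proof.
have := @measurable_fun_fubini_tonelli_F _ _ _ _ R (lebesgue_tuple R n) _ mGt
  (fun p => G0 _).
apply: eq_measurable_fun => x _.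
by rewrite ge0_integral_Rn_tuple//; exact: mGx.
Qed.

End step.

End lebesgue_Rn_recursion.

Section product_integrals.
Context {R : realType}.
Local Notation leb := (@lebesgue_measure R).
Local Notation lebn := (@lebesgue_Rn R).

Lemma measurable_row_prod n (w : 'I_n -> R -> R) :
  (forall i, measurable_fun [set: R] (w i)) ->
  measurable_fun [set: 'rV[R]_n] (fun v : 'rV[R]_n => \prod_i w i (v ord0 i)).
Proof.
move=> mw; apply: measurable_prod => i _.
exact: (measurableT_comp (mw i) (measurable_row_coord i)).
Qed.

Lemma measurable_row_map n (T : 'I_n -> R -> R) :
  (forall i, measurable_fun [set: R] (T i)) ->
  measurable_fun [set: 'rV[R]_n] (fun v : 'rV[R]_n => \row_i T i (v ord0 i)).
Proof.
move=> mT; apply: measurable_rowP => i; under eq_fun do rewrite mxE.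
exact: (measurableT_comp (mT i) (measurable_row_coord i)).
Qed.

Lemma prod_row_cons n (w : 'I_n.+1 -> R -> R) x (v : 'rV[R]_n) :
  \prod_i w i (row_cons x v ord0 i) =
  w ord0 x * \prod_i w (lift ord0 i) (v ord0 i).
Proof.
rewrite big_ord_recl row_cons0; congr (_ * _).
by apply: eq_bigr => i _; rewrite row_consS.
Qed.

Lemma map_row_cons n (T : 'I_n.+1 -> R -> R) x (v : 'rV[R]_n) :
  \row_i T i (row_cons x v ord0 i) =
  row_cons (T ord0 x) (\row_i T (lift ord0 i) (v ord0 i)).
Proof.
apply/rowP => i; rewrite mxE; case: (unliftP ord0 i) => [j ->|->].
  by rewrite !row_consS mxE.
by rewrite !row_cons0.
Qed.

Let measurable_mul_prod n (w : 'I_n -> R -> R) (G : 'rV[R]_n -> \bar R) :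
  (forall i, measurable_fun [set: R] (w i)) -> measurable_fun [set: 'rV[R]_n] G ->
  measurable_fun [set: 'rV[R]_n]
    (fun v => G v * (\prod_i w i (v ord0 i))%R%:E)%E.
Proof.
move=> mw mG; apply: emeasurable_funM => //.
by have /measurable_EFinP := measurable_row_prod mw.
Qed.

Let mul_prod_ge0 n (w : 'I_n -> R -> R) (G : 'rV[R]_n -> \bar R) :
  (forall i x, 0 <= w i x) -> (forall v, 0 <= G v)%E ->
  forall u v : 'rV[R]_n, (0 <= G u * (\prod_i w i (v ord0 i))%R%:E)%E.
Proof. by move=> w0 G0 u v; rewrite mule_ge0// lee_fin prodr_ge0. Qed.

(** Tonelli's theorem carries coordinatewise changes of variables over to
    the product. *)
Lemma ge0_integral_row_map n (T w rho : 'I_n -> R -> R) :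
  (forall i, measurable_fun [set: R] (T i)) ->
  (forall i, measurable_fun [set: R] (w i)) ->
  (forall i, measurable_fun [set: R] (rho i)) ->
  (forall i x, 0 <= w i x) -> (forall i x, 0 <= rho i x) ->
  (forall i (G : R -> \bar R), measurable_fun [set: R] G ->
    (forall y, (0 <= G y)%E) ->
    (\int[leb]_x (G (T i x) * (w i x)%:E) =
     \int[leb]_y (G y * (rho i y)%:E))%E) ->
  forall G : 'rV[R]_n -> \bar R, measurable_fun [set: 'rV[R]_n] G ->
    (forall v, (0 <= G v)%E) ->
  (\int[lebn n]_v (G (\row_i T i (v ord0 i))%R * (\prod_i w i (v ord0 i))%R%:E) =
   \int[lebn n]_v (G v * (\prod_i rho i (v ord0 i))%R%:E))%E.
Proof.
elim: n T w rho => [|n IH] T w rho mT mw mrho w0 rho0 TE G mG G0.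
  rewrite !integral_Rn0//; do ?[by move=> v; exact: mul_prod_ge0].
  - by rewrite !big_ord0; congr (G _ * _)%E; apply/rowP; case.
  - exact: measurable_mul_prod.
  - exact: (measurable_mul_prod mw (measurableT_comp mG (measurable_row_map mT))).
have mT' i : measurable_fun [set: R] (T (lift ord0 i)) by exact: mT.
have mw' i : measurable_fun [set: R] (w (lift ord0 i)) by exact: mw.
have mrho' i : measurable_fun [set: R] (rho (lift ord0 i)) by exact: mrho.
have mGx x : measurable_fun [set: 'rV[R]_n] (G \o row_cons x).
  exact: (measurableT_comp mG (@measurable_row_cons2 _ n x)).
rewrite [LHS]ge0_integral_RnS; [|exact: (measurable_mul_prod mw
  (measurableT_comp mG (measurable_row_map mT)))|by move=> v; exact: mul_prod_ge0].
rewrite [RHS]ge0_integral_RnS; [|exact: measurable_mul_prod|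
  by move=> v; exact: mul_prod_ge0].
pose H a := (\int[lebn n]_v (G (row_cons a v) *
  (\prod_i rho (lift ord0 i) (v ord0 i))%R%:E))%E.
have H0 a : (0 <= H a)%E.
  by apply: integral_ge0 => v _; rewrite mule_ge0// lee_fin prodr_ge0.
have mH : measurable_fun [set: R] H.
  pose K (v : 'rV[R]_n.+1) := (G v * (\prod_i
    (if unlift ord0 i is Some j then rho i (v ord0 i) else 1))%R%:E)%E.
  have KE a v : K (row_cons a v) = (G (row_cons a v) *
      (\prod_i rho (lift ord0 i) (v ord0 i))%R%:E)%E.
    congr (_ * _%:E)%E; rewrite big_ord_recl unlift_none mul1r.
    by apply: eq_bigr => i _; rewrite liftK row_consS.
  rewrite /H; under eq_fun do under eq_integral do rewrite -KE.
  apply: measurable_integral_RnS.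
    apply: emeasurable_funM => //; apply/measurable_EFinP.
    apply: (@measurable_row_prod _ (fun i x =>
      if unlift ord0 i is Some j then rho i x else 1)) => i.
    by case: unlift => [j|]; [exact: mrho|exact: measurable_cst].
  move=> v; rewrite mule_ge0// lee_fin prodr_ge0// => i _.
  by case: unlift => [j|].
transitivity (\int[leb]_x (H (T ord0 x) * (w ord0 x)%:E))%E.
  apply: eq_integral => x _.
  rewrite /H -(IH (fun i => T (lift ord0 i)) (fun i => w (lift ord0 i))
    (fun i => rho (lift ord0 i)) mT' mw' mrho' (fun i => w0 _) (fun i => rho0 _)
    (fun i => TE _) (G \o row_cons (T ord0 x)) (mGx _) (fun v => G0 _)).
  rewrite -ge0_integralZr//.
  - apply: eq_integral => v _; rewrite map_row_cons prod_row_cons.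
    by rewrite -muleA -EFinM (mulrC (w _ _)).
  - exact: (measurable_mul_prod mw'
      (measurableT_comp (mGx _) (measurable_row_map mT'))).
  - by move=> v _; apply: mule_ge0; [exact: G0|rewrite lee_fin prodr_ge0].
  - by rewrite lee_fin.
rewrite TE//; apply: eq_integral => x _.
rewrite -ge0_integralZr//.
- apply: eq_integral => v _; rewrite prod_row_cons.
  by rewrite -muleA -EFinM (mulrC (rho _ _)).
- exact: (measurable_mul_prod mrho' (mGx _)).
- by move=> v _; apply: mule_ge0; [exact: G0|rewrite lee_fin prodr_ge0].
- by rewrite lee_fin.
Qed.

(** Adding 1 makes the cosines nonnegative, so that Tonelli's theorem applies
    without an integrability argument; the phase al is what the other
    coordinates contribute. *)
Lemma integral_row_1Dcos n (xi rho : 'I_n -> R -> R) (k : 'I_n -> int) :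
  (forall i, measurable_fun [set: R] (xi i)) ->
  (forall i, measurable_fun [set: R] (rho i)) ->
  (forall i x, 0 <= rho i x) ->
  (forall i, (\int[leb]_x (rho i x)%:E = 1)%E) ->
  (forall i al, (\int[leb]_x ((1 + cos (2 * pi * ((k i)%:~R * xi i x) + al)) *
     rho i x)%:E = (1 + cos al *+ (k i == 0))%:E)%E) ->
  forall al, (\int[lebn n]_v
    ((1 + cos (2 * pi * (\sum_i (k i)%:~R * xi i (v ord0 i)) + al)) *
     \prod_i rho i (v ord0 i))%:E = (1 + cos al *+ [forall i, k i == 0])%:E)%E.
Proof.
pose P b := 1 + cos b : R.
have P0 b : 0 <= P b by rewrite /P -lerBlDl sub0r cos_geN1.
have mP : measurable_fun [set: R] P.
  apply: measurable_funD; first exact: measurable_cst.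
  by apply: continuous_measurable_fun; exact: continuous_cos.
have mS m (k' : 'I_m -> int) (xi' : 'I_m -> R -> R) :
    (forall i, measurable_fun [set: R] (xi' i)) ->
    measurable_fun [set: 'rV[R]_m]
      (fun v : 'rV[R]_m => \sum_i (k' i)%:~R * xi' i (v ord0 i)).
  move=> m'; apply: measurable_sum => i; apply: measurable_funM => //.
  exact: (measurableT_comp (m' i) (measurable_row_coord i)).
have mPS m (k' : 'I_m -> int) (xi' rho' : 'I_m -> R -> R) b :
    (forall i, measurable_fun [set: R] (xi' i)) ->
    (forall i, measurable_fun [set: R] (rho' i)) ->
    measurable_fun [set: 'rV[R]_m] (fun v : 'rV[R]_m =>
      (P (2 * pi * (\sum_i (k' i)%:~R * xi' i (v ord0 i)) + b) *
       \prod_i rho' i (v ord0 i))%:E).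
  move=> m' r'; apply/measurable_EFinP; apply: measurable_funM.
    apply: (measurableT_comp mP); apply: measurable_funD => //.
    by apply: measurable_funM => //; exact: mS.
  exact: measurable_row_prod.
elim: n xi rho k => [|n IH] xi rho k mxi mrho rho0 rho1 E al.
  rewrite integral_Rn0//; last 2 first.
  - exact: (mPS _ k).
  - by move=> v; rewrite lee_fin mulr_ge0 ?prodr_ge0// P0.
  rewrite !big_ord0 mulr1 mulr0 add0r.
  by rewrite (_ : [forall i, _])//; apply/forallP; case.
rewrite ge0_integral_RnS; [|exact: (mPS _ k)|by
  move=> v; rewrite lee_fin mulr_ge0 ?prodr_ge0// P0].
have [b0 b0E] : exists b0, b0 = [forall i, k (lift ord0 i) == 0] by eexists.
transitivity (\int[leb]_x ((1 + cos (2 * pi * ((k ord0)%:~R * xi ord0 x) + al) *+ b0) *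
  rho ord0 x)%:E)%E.
  apply: eq_integral => x _.
  have IHx := IH (fun i => xi (lift ord0 i)) (fun i => rho (lift ord0 i))
    (fun i => k (lift ord0 i)) (fun i => mxi _) (fun i => mrho _)
    (fun i => rho0 _) (fun i => rho1 _) (fun i => E _) (2 * pi * ((k ord0)%:~R * xi ord0 x) + al).
  rewrite -b0E in IHx; rewrite [RHS]EFinM -IHx -ge0_integralZr//.
  - apply: eq_integral => v _; rewrite -EFinM prod_row_cons.
    rewrite big_ord_recl row_cons0; congr EFin; rewrite [RHS]mulrC [RHS]mulrCA.
    rewrite [X in cos X](_ : _ = 2 * pi * (\sum_i (k (lift ord0 i))%:~R *
      xi (lift ord0 i) (v ord0 i)) + (2 * pi * ((k ord0)%:~R * xi ord0 x) + al))//.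
    under eq_bigr do rewrite row_consS.
    by rewrite mulrDr addrCA addrA.
  - exact: (mPS _ (fun i => k (lift ord0 i)) (fun i => xi (lift ord0 i))
      (fun i => rho (lift ord0 i))).
  - by move=> v _; rewrite lee_fin mulr_ge0 ?prodr_ge0// P0.
  - by rewrite lee_fin.
have -> : [forall i, k i == 0] = (k ord0 == 0) && b0.
  rewrite b0E; apply/forallP/andP => [k0|[k0 /forallP kS] i].
    by split; [|apply/forallP => i].
  by case: (unliftP ord0 i) => [j ->|->].
case: b0 {b0E}; last first.
  rewrite andbF [in RHS]mulr0n [in RHS]addr0.
  apply: etrans (rho1 ord0); apply: eq_integral => x _.
  by rewrite mulr0n addr0 mul1r.
by rewrite andbT; exact: E.
Qed.


(** On such a hyperplane a step polynomial is evaluated at its threshold, where it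
    converges to neither 0 nor 1. *)
Lemma lebesgue_Rn_hyperplane n (i : 'I_n) (b : R) :
  lebn n [set v | v ord0 i = b] = 0%E.
Proof.
have mA m (j : 'I_m) : measurable [set v : 'rV[R]_m | v ord0 j = b].
  rewrite (_ : [set _ | _] = (fun v : 'rV[R]_m => v ord0 j) @^-1` [set b])//.
  rewrite -[X in measurable X]setTI.
  by apply: measurable_row_coord => //; exact: measurable_set1.
have lebnE m (j : 'I_m) : (lebn m [set v | v ord0 j = b] =
    \int[lebn m]_v (\1_[set v : 'rV[R]_m | v ord0 j = b] v)%:E)%E.
  rewrite integral_indic//; last exact: mA.
  by apply: (congr1 (lebn m)); apply/seteqP; split => // v [].
elim: n i => [[]//|n IH] i.
rewrite lebnE ge0_integral_RnS//; last first.
  by apply/measurable_EFinP; apply: measurable_indic; exact: mA.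
have {i} [->|[j ->]] : i = ord0 \/ exists j, i = lift ord0 j.
- by case: (unliftP ord0 i) => [j ->|->]; [right; exists j|left].
- rewrite [LHS](_ : _ = \int[leb]_(x in [set b]) \int[lebn n]_v 1)%E.
    by rewrite integral_set1.
  rewrite [RHS]integral_mkcond; apply: eq_integral => x _; rewrite patchE.
  case: ifPn => [|/negP]; rewrite inE /= => xb.
    by apply: eq_integral => v _; rewrite indicE mem_set//= row_cons0.
  by rewrite integral0_eq// => v _; rewrite indicE memNset//= row_cons0.
- apply: integral0_eq => x _.
  rewrite -[RHS](IH j) lebnE; apply: eq_integral => v _.
  rewrite !indicE; congr (nat_of_bool _)%:R%:E; apply/idP/idP;
    by rewrite !inE /= row_consS.
Qed.

End product_integrals.

(** * Uniqueness of Fourier coefficients *)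

Section step_polynomial.
Context {R : realType}.
Implicit Types a t : R.

(** Polynomials, bounded by 0 and 1 on the unit interval, that converge there to
    the step function with threshold 1/2: the number t ^+ n is to be compared
    with 2^-n, and Bernoulli's inequality bounds both the polynomial and its
    complement. *)
Definition step_poly n t : R := 1 - (1 - t ^+ n) ^+ (2 ^ n).

Lemma onem_exp_ge a K : 0 <= a <= 1 -> 1 - K%:R * a <= (1 - a) ^+ K.
Proof.
move=> /andP[a0 a1]; elim: K => [|K IH]; first by rewrite expr0 mul0r subr0.
rewrite exprS -natr1; have h : (1 - a) * (1 - K%:R * a) <= (1 - a) * (1 - a) ^+ K.
  by rewrite ler_wpM2l// subr_ge0.
apply: le_trans h; have : 0 <= K%:R * a * a by rewrite !mulr_ge0.
by nra.
Qed.

Lemma onem_exp_le a K : 0 <= a <= 1 -> (1 - a) ^+ K * (1 + K%:R * a) <= 1.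
Proof.
move=> /andP[a0 a1]; elim: K => [|K IH]; first by rewrite expr0 mul0r addr0 mulr1.
rewrite exprSr -natr1; apply: le_trans IH; rewrite -mulrA ler_wpM2l//.
  by rewrite exprn_ge0// subr_ge0.
have : 0 <= K%:R * a * a by rewrite !mulr_ge0.
have : 0 <= a * a by rewrite mulr_ge0.
by nra.
Qed.

Lemma step_poly_itv n t : 0 <= t <= 1 -> 0 <= step_poly n t <= 1.
Proof.
move=> /andP[t0 t1]; rewrite /step_poly.
have tn0 : 0 <= t ^+ n by rewrite exprn_ge0.
have tn1 : t ^+ n <= 1 by rewrite exprn_ile1.
rewrite subr_ge0 lerBlDr lerDl exprn_ge0 ?subr_ge0// andbT.
by rewrite exprn_ile1 ?subr_ge0// lerBlDr lerDl.
Qed.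

Lemma step_poly_cvg0 t : 0 <= t < 2^-1 -> step_poly n t @[n --> \oo] --> (0 : R).
Proof.
move=> /andP[t0 t12].
have t01 : 0 <= t <= 1 by rewrite t0/= (le_trans (ltW t12))// invf_le1// ler1n.
apply: (@squeeze_cvgr _ _ _ _ (cst 0) (fun n => (2 * t) ^+ n)).
- apply: nearW => n; have /andP[-> _]/= := step_poly_itv n t01.
  rewrite /step_poly lerBlDr -lerBlDl exprMn -natrX.
  apply: onem_exp_ge; case/andP: t01 => _ t1.
  by rewrite exprn_ge0// exprn_ile1.
- exact: cvg_cst.
- apply: cvg_expr; rewrite ger0_norm ?mulr_ge0//.
  by rewrite mulrC -ltr_pdivlMr// mul1r.
Qed.

Lemma step_poly_cvg1 t : 2^-1 < t <= 1 -> step_poly n t @[n --> \oo] --> (1 : R).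
Proof.
move=> /andP[t12 t1]; have t0 : 0 <= t by rewrite (le_trans _ (ltW t12)).
have t2 : 1 < 2 * t by rewrite mulrC -ltr_pdivrMr// mul1r.
have t20 : 0 < 2 * t by rewrite (lt_trans _ t2).
have t01 : 0 <= t <= 1 by rewrite t0.
apply: (@squeeze_cvgr _ _ _ _ (fun n => 1 - (2 * t)^-1 ^+ n : R) (cst (1 : R))).
- apply: nearW => n; have /andP[_ ->]/= := step_poly_itv n t01.
  rewrite andbT /step_poly lerB// exprVn -[leRHS]mul1r.
  rewrite ler_pdivlMr ?exprn_gt0//.
  have tn : 0 <= t ^+ n <= 1 by rewrite exprn_ge0// exprn_ile1.
  apply: le_trans (onem_exp_le (2 ^ n) tn).
  rewrite ler_wpM2l ?exprn_ge0 ?subr_ge0 ?exprn_ile1//.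
  by rewrite exprMn natrX lerDr.
- rewrite -[X in _ --> X]subr0; apply: cvgB; first exact: cvg_cst.
  apply: cvg_expr; rewrite ger0_norm ?invr_ge0 ?(ltW t20)//.
  by rewrite invf_lt1.
- exact: cvg_cst.
Qed.

End step_polynomial.

Section trigonometric_uniqueness.
Context {R : realType} {n : nat}.
Local Notation Rn := 'rV[R]_n.
Local Notation lebn := (@lebesgue_Rn R n).

(** The characters of the torus are read through a coordinatewise map xi into
    the open unit cube; being strictly increasing, xi separates points. *)
Variables (xi : 'I_n -> R -> R) (v : Rn -> R).
Hypotheses (mxi : forall i, measurable_fun [set: R] (xi i))
  (xi_itv : forall i y, unit_itv (xi i y))
  (xi_lt : forall i y z, (xi i y < xi i z) = (y < z)).
Hypothesis iv : lebn.-integrable setT (EFin \o v).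

Definition coord_map (y : Rn) : Rn := \row_i xi i (y ord0 i).

Definition char_cos (k : 'rV[int]_n) (al : R) (y : Rn) : R :=
  cos (2 * pi * zdot k (coord_map y) + al).

Hypothesis v_ortho : forall k al,
  (\int[lebn]_y (v y * char_cos k al y)%:E = 0)%E.

Definition bounded_mfun (f : Rn -> R) :=
  measurable_fun [set: Rn] f /\ exists C, forall y, `|f y| <= C.

Definition annihilator (f : Rn -> R) := bounded_mfun f /\
  forall k al, (\int[lebn]_y (v y * (f y * char_cos k al y))%:E = 0)%E.

(** Unlike the annihilator, this class is closed under products.  It contains the
    characters, hence the polynomials in them, hence the indicators of the sets
    {y | b < y i}; closure under bounded limits then extends it to the
    indicators of all measurable sets. *)
Definition multiplier (g : Rn -> R) :=
  forall f, annihilator f -> annihilator (f \* g).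

Lemma measurable_zdot (k : 'rV[int]_n) :
  measurable_fun [set: Rn] (fun y => zdot k (coord_map y)).
Proof.
apply: measurable_sum => i; apply: measurable_funM => //.
under eq_fun do rewrite mxE.
exact: (measurableT_comp (mxi i) (measurable_row_coord i)).
Qed.

Lemma measurable_char_cos k al : measurable_fun [set: Rn] (char_cos k al).
Proof.
apply: (measurableT_comp (continuous_measurable_fun (@continuous_cos R))).
apply: measurable_funD => //; apply: measurable_funM => //.
exact: measurable_zdot.
Qed.

Lemma bounded_mfunM f g : bounded_mfun f -> bounded_mfun g ->
  bounded_mfun (f \* g).
Proof.
move=> [mf [C fC]] [mg [D gD]]; split; first exact: measurable_funM.
by exists (C * D) => y; rewrite normrM ler_pM.
Qed.

Lemma bounded_mfunD f g : bounded_mfun f -> bounded_mfun g ->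
  bounded_mfun (f \+ g).
Proof.
move=> [mf [C fC]] [mg [D gD]]; split; first exact: measurable_funD.
by exists (C + D) => y; rewrite (le_trans (ler_normD _ _))// lerD.
Qed.

Lemma bounded_cst c : bounded_mfun (cst c).
Proof. by split; [exact: measurable_cst|exists `|c| => y]. Qed.

Lemma bounded_char_cos k al : bounded_mfun (char_cos k al).
Proof.
split; first exact: measurable_char_cos.
by exists 1 => y; rewrite ler_norml cos_geN1 cos_le1.
Qed.

Lemma integrable_mul_bounded f : bounded_mfun f ->
  lebn.-integrable setT (fun y => (v y * f y)%:E).
Proof.
move=> [mf [C fC]].
have mv : measurable_fun [set: Rn] v by apply/measurable_EFinP; exact: measurable_int iv.
apply: (@le_integrable _ _ _ lebn setT _ _ (fun y => (C%:E * (v y)%:E)%E)) => //.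
- by apply/measurable_EFinP; exact: measurable_funM.
- move=> y _; rewrite -EFinM !abse_EFin lee_fin !normrM mulrC ler_wpM2r//.
  by rewrite (le_trans (fC y))// ler_norm.
- exact: integrableZl.
Qed.

Let integrable_mul_char f k al : bounded_mfun f ->
  lebn.-integrable setT (fun y => (v y * (f y * char_cos k al y))%:E).
Proof.
move=> bf; apply: (@integrable_mul_bounded (f \* char_cos k al)).
exact/bounded_mfunM/bounded_char_cos.
Qed.

Lemma annihilator1 : annihilator (cst 1).
Proof.
split=> [|k al]; first exact: bounded_cst.
by rewrite -[RHS](v_ortho k al); apply: eq_integral => y _; rewrite mul1r.
Qed.

Lemma annihilatorD f g : annihilator f -> annihilator g -> annihilator (f \+ g).
Proof.
move=> [bf f0] [bg g0]; split=> [|k al]; first exact: bounded_mfunD.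
under eq_integral do rewrite /= mulrDl mulrDr EFinD.
by rewrite integralD//= ?f0 ?g0 ?adde0//; exact: integrable_mul_char.
Qed.

Lemma annihilatorZ c f : annihilator f -> annihilator (fun y => f y * c).
Proof.
move=> [bf f0]; split=> [|k al]; first exact: (bounded_mfunM bf (bounded_cst c)).
rewrite (eq_integral (fun y => c%:E * (v y * (f y * char_cos k al y))%:E)%E);
  last by move=> y _; rewrite -EFinM; congr EFin; ring.
by rewrite integralZl ?f0 ?mule0//; exact: integrable_mul_char.
Qed.

Lemma multiplier_cst c : multiplier (cst c).
Proof. by move=> f; exact: annihilatorZ. Qed.

Lemma multiplierD g h : multiplier g -> multiplier h -> multiplier (g \+ h).
Proof.
move=> mg mh f af; have := annihilatorD (mg f af) (mh f af).
by congr annihilator; apply/funext => y /=; rewrite mulrDr.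
Qed.

Lemma multiplierM g h : multiplier g -> multiplier h -> multiplier (g \* h).
Proof.
move=> mg mh f /mg /mh; congr annihilator.
by apply/funext => y /=; rewrite mulrA.
Qed.

Lemma multiplierX g m : multiplier g -> multiplier (fun y => g y ^+ m).
Proof.
move=> mg; elim: m => [|m IH]; first exact: (multiplier_cst 1).
have := multiplierM mg IH; congr multiplier.
by apply/funext => y /=; rewrite exprS.
Qed.

Lemma multiplier_onem g : multiplier g -> multiplier (fun y => 1 - g y).
Proof.
move=> mg; have := multiplierD (multiplier_cst 1)
  (multiplierM (multiplier_cst (-1)) mg).
by congr multiplier; apply/funext => y /=; rewrite mulN1r.
Qed.

(** cos a cos b = (cos (a + b) + cos (a - b)) / 2, and characters add up. *)
Lemma multiplier_char k al : multiplier (char_cos k al).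
Proof.
move=> f [bf f0]; split=> [|k' al'].
  exact/bounded_mfunM/bounded_char_cos.
have prod y : v y * (f y * char_cos k al y * char_cos k' al' y) =
    v y * (f y * char_cos (k + k') (al + al') y) * 2^-1 +
    v y * (f y * char_cos (k - k') (al - al') y) * 2^-1.
  have zD (a b : 'rV[int]_n) x : zdot (a + b) x = zdot a x + zdot b x :> R.
    rewrite -big_split/=; apply: eq_bigr => i _.
    by rewrite mxE intrD mulrDl.
  have zN (a : 'rV[int]_n) x : zdot (- a) x = - zdot a x :> R.
    rewrite /zdot -sumrN; apply: eq_bigr => i _.
    by rewrite mxE intrN mulNr.
  rewrite /char_cos !zD zN.
  set A := zdot k _; set B := zdot k' _.
  rewrite (_ : 2 * pi * (A + B) + _ = (2 * pi * A + al) + (2 * pi * B + al'));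
    last by ring.
  rewrite (_ : 2 * pi * (A - B) + _ = (2 * pi * A + al) - (2 * pi * B + al'));
    last by ring.
  by move: (2 * pi * A + al) (2 * pi * B + al') => a b; rewrite cosD cosB; field.
under eq_integral => y _ do
  rewrite prod EFinD [X in (X + _)%E]EFinM [X in (_ + X)%E]EFinM.
rewrite integralD//=; [|by apply: integrableZr => //; exact: integrable_mul_char..].
rewrite !integralZr ?f0 ?mul0e ?adde0//; exact: integrable_mul_char.
Qed.

(** Dominated convergence makes the multipliers a class closed under bounded
    almost everywhere limits. *)
Lemma multiplier_lim (g_ : nat -> Rn -> R) (g : Rn -> R) (C : R) :
  (forall m, multiplier (g_ m)) -> (forall m, measurable_fun [set: Rn] (g_ m)) ->
  measurable_fun [set: Rn] g ->
  (forall m y, `|g_ m y| <= C) -> (forall y, `|g y| <= C) ->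
  {ae lebn, forall y, g_ m y @[m --> \oo] --> g y} ->
  multiplier g.
Proof.
move=> mulg mg_ mg g_C gC g_g f af; have [bf _] := af.
have bg : bounded_mfun g by split => //; exists C.
split=> [|k al]; first exact: bounded_mfunM.
pose F m y := (v y * (f y * g_ m y * char_cos k al y))%:E.
pose G y := (v y * (f y * g y * char_cos k al y))%:E.
have bF m : bounded_mfun (f \* g_ m).
  by apply: bounded_mfunM => //; split => //; exists C.
have iF m : lebn.-integrable setT (F m) by exact: (integrable_mul_char k al (bF m)).
have iG : lebn.-integrable setT G.
  exact: (integrable_mul_char k al (bounded_mfunM bf bg)).
have [_ [D fD]] := bf.
have ivD : lebn.-integrable setT (fun y => (D * C)%:E * `|(v y)%:E|)%E.
  by apply: integrableZl => //; exact: integrable_abse.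
have FG : {ae lebn, forall y, setT y -> F m y @[m --> \oo] --> G y}.
  apply: filterS g_g => y gy _; apply: cvg_EFin; first exact: nearW.
  apply: cvgMr; apply: cvgMl; exact: cvgMr.
have FvD : {ae lebn, forall y m, setT y -> (`|F m y| <= (D * C)%:E * `|(v y)%:E|)%E}.
  apply: aeW => y m _; rewrite !abse_EFin -EFinM lee_fin !normrM mulrC.
  rewrite ler_wpM2r// -[leRHS]mulr1 ler_pM ?mulr_ge0//; first exact: ler_pM.
  by rewrite ler_norml cos_geN1 cos_le1.
have [_ _] := @dominated_convergence _ _ _ lebn setT measurableT F G _
  (fun m => measurable_int _ (iF m)) (measurable_int _ iG) FG ivD FvD.
have F0 m : (\int[lebn]_y F m y = 0)%E by exact: (mulg m f af).2.
rewrite (_ : [sequence _]_m = cst 0%E); last by apply/funext.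
by move=> /(cvg_unique _ (@cvg_cst _ _ _ _ _)) => ->.
Qed.

(** A trigonometric polynomial in xi i (y i) that lies above 1/2 exactly when
    b < y i. *)
Let ramp i b y : R := 2^-1 - 4^-1 * sin (pi * xi i b) +
  4^-1 * char_cos (delta_mx ord0 i) (- (pi * xi i b) - pi / 2) y.

(** The cosine is positive and the sine has the sign of xi y - xi b, because both
    points lie in the open unit interval. *)
Let rampE i b y : ramp i b y = 2^-1 + 2^-1 *
  (cos (pi * xi i (y ord0 i)) * sin (pi * xi i (y ord0 i) - pi * xi i b)).
Proof.
rewrite /ramp /char_cos (_ : zdot _ _ = xi i (y ord0 i)); last first.
  rewrite /zdot (bigD1 i)//= big1 ?addr0 => [|j ji].
    by rewrite !mxE !eqxx mul1r.
  by rewrite mxE eqxx (negbTE ji) mul0r.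
move: (pi * xi i b) => B.
rewrite addrA cosBpihalf -mulrA; move: (pi * xi i (y ord0 i)) => X.
rewrite (_ : 2 * X - B = X + (X - B)); last by ring.
rewrite {1}(_ : B = X - (X - B)); last by ring.
by move: (X - B) => D; rewrite (sinD X D) (sinB X D); field.
Qed.

Let ramp_itv i b y : 0 <= ramp i b y <= 1.
Proof.
rewrite rampE; set c := cos _; set s := sin _.
have /andP[] : -1 <= c * s <= 1.
  rewrite -ler_norml normrM mulr_ile1// ler_norml ?cos_geN1 ?cos_le1//.
  by rewrite sin_geN1 sin_le1.
by move=> *; apply/andP; split; lra.
Qed.

Let cos_xi_gt0 i y : 0 < cos (pi * xi i y).
Proof.
have := xi_itv i y; rewrite unit_itvE => /andP[x1 x2].
by apply: cos_gt0_pihalf; have := pi_gt0 R; nra.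
Qed.

Let sin_xi_gt0 i y z : z < y -> 0 < sin (pi * xi i y - pi * xi i z).
Proof.
rewrite -(xi_lt i) => zy.
have := xi_itv i y; rewrite unit_itvE => /andP[y1 y2].
have := xi_itv i z; rewrite unit_itvE => /andP[z1 z2].
by apply: sin_gt0_pi; rewrite -mulrBr; have := pi_gt0 R => pi0;
  apply/andP; split; [rewrite mulr_gt0 ?subr_gt0|nra].
Qed.

Let ramp_gt i b (y : Rn) : b < y ord0 i -> 2^-1 < ramp i b y.
Proof.
by move=> by_; rewrite rampE ltrDl !mulr_gt0// sin_xi_gt0.
Qed.

Let ramp_lt i b (y : Rn) : y ord0 i < b -> ramp i b y < 2^-1.
Proof.
move=> yb; rewrite rampE -opprB sinN mulrN mulrN gtrDl oppr_lt0.
by rewrite !mulr_gt0// sin_xi_gt0.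
Qed.

Let multiplier_ramp i b : multiplier (ramp i b).
Proof.
apply: multiplierD; first exact: multiplier_cst.
apply: multiplierM; [exact: multiplier_cst|exact: multiplier_char].
Qed.

Let measurable_ramp i b : measurable_fun [set: Rn] (ramp i b).
Proof.
apply: measurable_funD; first exact: measurable_cst.
apply: measurable_funM; [exact: measurable_cst|exact: measurable_char_cos].
Qed.

Lemma measurable_ray (i : 'I_n) b : measurable [set y : Rn | b < y ord0 i].
Proof.
rewrite (_ : [set _ | _] = (fun y : Rn => y ord0 i) @^-1` `]b, +oo[%classic).
  rewrite -[X in measurable X]setTI; exact: measurable_row_coord.
by apply/seteqP; split => y /=; rewrite in_itv/= andbT.
Qed.

Lemma multiplier_ray (i : 'I_n) b :
  multiplier (\1_[set y : Rn | b < y ord0 i] : Rn -> R).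
Proof.
apply: (@multiplier_lim (fun m y => step_poly m (ramp i b y)) _ 1).
- by move=> m; apply/multiplier_onem/multiplierX/multiplier_onem/multiplierX.
- by move=> m; apply: measurable_funB => //; apply: measurable_funX;
    apply: measurable_funB => //; exact: measurable_funX.
- by apply: measurable_indic; exact: measurable_ray.
- move=> m y; have /andP[p0 p1] := step_poly_itv m (ramp_itv i b y).
  by rewrite ger0_norm.
- by move=> y; rewrite indicE; case: (_ \in _); rewrite ?normr1 ?normr0.
exists [set y : Rn | y ord0 i = b]; split.
- rewrite (_ : [set _ | _] = (fun y : Rn => y ord0 i) @^-1` [set b])//.
  rewrite -[X in measurable X]setTI.
  by apply: measurable_row_coord => //; exact: measurable_set1.
- exact: lebesgue_Rn_hyperplane.
move=> y /= ncv; apply: contrapT => /eqP yb; apply: ncv.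
have /andP[t0 t1] := ramp_itv i b y.
rewrite indicE; case: ltgtP yb => // yb _.
- rewrite memNset/=; last by rewrite ltNge (ltW yb).
  by apply: step_poly_cvg0; rewrite t0 ramp_lt.
- by rewrite mem_set//=; apply: step_poly_cvg1; rewrite t1 ramp_gt.
Qed.

Let indic_multiplier (A : set Rn) := measurable A /\ multiplier (\1_A : Rn -> R).

Let indic_multiplierC A : indic_multiplier A -> indic_multiplier (~` A).
Proof.
move=> [mA gA]; split; first exact: measurableC.
have := multiplier_onem gA; congr multiplier; apply/funext => y.
by rewrite !indicE in_setC; case: (_ \in _); rewrite ?subrr ?subr0.
Qed.

Let indic_multiplierI A B : indic_multiplier A -> indic_multiplier B -> indic_multiplier (A `&` B).
Proof.
move=> [mA gA] [mB gB]; split; first exact: measurableI.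
have := multiplierM gA gB; congr multiplier; apply/funext => y /=.
by rewrite !indicE in_setI; do 2 case: (_ \in _); rewrite ?mulr1 ?mulr0 ?mul0r.
Qed.

Let indic_multiplier0 : indic_multiplier set0.
Proof.
split=> //; have := multiplier_cst 0; congr multiplier.
by apply/funext => y; rewrite indicE in_set0.
Qed.

Let indic_multiplier_bigcup (F : nat -> set Rn) : (forall k, indic_multiplier (F k)) ->
  indic_multiplier (\bigcup_k F k).
Proof.
move=> gF; pose G m := \big[setU/set0]_(k < m) F k.
have gG m : indic_multiplier (G m).
  rewrite /G; elim: m => [|m IH]; first by rewrite big_ord0.
  rewrite big_ord_recr/= -[_ `|` _]setCK setCU.
  by apply/indic_multiplierC/indic_multiplierI; exact: indic_multiplierC.
split; first by apply: bigcup_measurable => k _; exact: (gF k).1.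
apply: (@multiplier_lim (fun m => \1_(G m)) _ 1) => //.
- by move=> m; exact: (gG m).2.
- by move=> m; apply: measurable_indic; exact: (gG m).1.
- by apply: measurable_indic; apply: bigcup_measurable => k _; exact: (gF k).1.
- by move=> m y; rewrite indicE; case: (_ \in _); rewrite ?normr1 ?normr0.
- by move=> y; rewrite indicE; case: (_ \in _); rewrite ?normr1 ?normr0.
apply: aeW => y; apply: cvg_near_cst.
have [[k _ Fky]|nF] := pselect ((\bigcup_k F k) y).
  exists k.+1 => // m /= km; rewrite !indicE !mem_set//; first by exists k.
  by rewrite /G -bigcup_mkord; exists k.
apply: nearW => m; rewrite !indicE !memNset//.
by rewrite /G -bigcup_mkord => -[k _ Fky]; apply: nF; exists k.
Qed.

(** The sets whose indicator is a multiplier form a sigma-algebra, and it contains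
    the half-spaces that generate the Borel sets. *)
Lemma multiplier_indic (A : set Rn) : measurable A ->
  multiplier (\1_A : Rn -> R).
Proof.
suff : measurable `<=` indic_multiplier by move=> /[apply] -[].
apply: smallest_sub.
  split=> [|B|F]; [exact: indic_multiplier0|by rewrite setTD; exact: indic_multiplierC|exact: indic_multiplier_bigcup].
move=> A'; rewrite -bigcup_seq => -[i _ [B mB <-]]; rewrite setTI.
have {}mB : (@ocitv R).-sigma.-measurable B by exact: mB.
rewrite RGenOInfty.measurableE in mB; move: B mB.
apply: (@smallest_sub _ _ _ (fun B => indic_multiplier ((fun y : Rn => y ord0 i) @^-1` B))).
  split=> [|B|F].
  - by rewrite preimage_set0; exact: indic_multiplier0.
  - by rewrite setTD preimage_setC; exact: indic_multiplierC.
  - by move=> gF; rewrite preimage_bigcup; exact: indic_multiplier_bigcup.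
move=> _ [b ->].
rewrite (_ : _ @^-1` _ = [set y : Rn | b < y ord0 i]); last first.
  by apply/seteqP; split => y /=; rewrite in_itv/= andbT.
split; [exact: measurable_ray|exact: multiplier_ray].
Qed.

(** The constant 1 times the indicator of A is in the annihilator; testing it
    against the trivial character shows that v integrates to 0 over A. *)
Lemma trigonometric_uniqueness : {ae lebn, forall y, v y = 0}.
Proof.
have : ae_eq lebn setT (EFin \o v) (cst 0%E).
  apply: integral_ae_eq => //.
  move=> A _ mA; rewrite integral0 integral_mkcond.
  have [_ /(_ 0 0)] := multiplier_indic mA annihilator1.
  congr (_ = _); apply: eq_integral => y _; rewrite patchE /= indicE.
  rewrite /char_cos (_ : zdot _ _ = 0); last first.
    by rewrite /zdot big1// => i _; rewrite mxE mul0r.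
  by rewrite mulr0 addr0 cos0 mul1r mulr1; case: ifPn; rewrite ?mulr1 ?mulr0.
by apply: filterS => y /(_ I) [].
Qed.

End trigonometric_uniqueness.

(** * Sampling on rank-1 lattices *)

Section complex_exponential.
Context {R : realType}.
Implicit Types (a b x : R) (z w : R[i]).

Lemma cabsM z w : cabs (z * w) = cabs z * cabs w.
Proof. by case: z w => [a b] [c e]; exact: (ComplexField.Normc.normcM (Complex a b) (Complex c e)). Qed.

Lemma cabsD z w : cabs (z + w) <= cabs z + cabs w.
Proof. by case: z w => [a b] [c e]; exact: (le_normcD (Complex a b) (Complex c e)). Qed.

Lemma cabsN z : cabs (- z) = cabs z.
Proof. by case: z => [a b]; rewrite /cabs /= !sqrrN. Qed.

Lemma cabs0 : cabs (0 : R[i]) = 0.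
Proof. by rewrite /cabs /= expr0n addr0 sqrtr0. Qed.

Lemma cabs_ge0 z : 0 <= cabs z.
Proof. exact: sqrtr_ge0. Qed.

Lemma cabs_real (r : R) : cabs r%:C%C = `|r|.
Proof. by rewrite /cabs /= expr0n addr0 sqrtr_sqr. Qed.

Lemma cabs_sum (I : Type) (s : seq I) (P : pred I) (f : I -> R[i]) :
  cabs (\sum_(i <- s | P i) f i) <= \sum_(i <- s | P i) cabs (f i).
Proof.
elim/big_ind2 : _ => [|u a v b ua vb|//]; first by rewrite cabs0.
by rewrite (le_trans (cabsD _ _))// lerD.
Qed.

Lemma Re_sum (I : Type) (s : seq I) (P : pred I) (f : I -> R[i]) :
  complex.Re (\sum_(i <- s | P i) f i) = \sum_(i <- s | P i) complex.Re (f i).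
Proof. by apply: (big_morph (@complex.Re R)) => // -[? ?] []. Qed.

Lemma Im_sum (I : Type) (s : seq I) (P : pred I) (f : I -> R[i]) :
  complex.Im (\sum_(i <- s | P i) f i) = \sum_(i <- s | P i) complex.Im (f i).
Proof. by apply: (big_morph (@complex.Im R)) => // -[? ?] []. Qed.

Lemma normr_Re z : `|complex.Re z| <= cabs z.
Proof. by rewrite -sqrtr_sqr ler_wsqrtr// lerDl sqr_ge0. Qed.

Lemma normr_Im z : `|complex.Im z| <= cabs z.
Proof. by rewrite -sqrtr_sqr ler_wsqrtr// lerDr sqr_ge0. Qed.

Lemma cis2pi0 : cis2pi 0 = 1 :> R[i].
Proof. by rewrite /cis2pi mulr0 cos0 sin0. Qed.

Lemma cis2piD a b : cis2pi (a + b) = cis2pi a * cis2pi b :> R[i].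
Proof.
rewrite /cis2pi mulrDr cosD sinD; apply/eqP; rewrite eq_complex /=.
by rewrite eqxx/= addrC.
Qed.

Lemma cabs_cis2pi a : cabs (cis2pi a) = 1.
Proof. by rewrite /cabs /= cos2Dsin2 sqrtr1. Qed.

Lemma cis2pi1 : cis2pi 1 = 1 :> R[i].
Proof.
by rewrite /cis2pi mulr1 mulr_natl cos2pi sin2pi.
Qed.

Lemma cis2piMn a k : cis2pi (k%:R * a) = cis2pi a ^+ k :> R[i].
Proof.
elim: k => [|k IH]; first by rewrite mul0r cis2pi0 expr0.
by rewrite -natr1 mulrDl mul1r cis2piD IH exprSr.
Qed.

Lemma cis2piN a : cis2pi (- a) = conjc (cis2pi a) :> R[i].
Proof. by rewrite /cis2pi mulrN cosN sinN. Qed.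

Lemma cis2pi_int (k : int) : cis2pi k%:~R = 1 :> R[i].
Proof.
have nat_case j : cis2pi j%:R = 1 :> R[i].
  by rewrite -[j%:R]mulr1 cis2piMn cis2pi1 expr1n.
case: k => [j|j]; first exact: nat_case.
by rewrite NegzE mulrNz cis2piN nat_case conjc1.
Qed.

Lemma cis2pi_neq1 a : 0 < a < 1 -> cis2pi a != 1 :> R[i].
Proof.
move=> /andP[a0 a1]; rewrite eq_complex /= negb_and; apply/orP; left.
have -> : 2 * pi * a = (pi * a) *+ 2 by rewrite mulr2n; ring.
rewrite cos_mulr2n cos2sin2.
have sa : 0 < sin (pi * a).
  have pi0 := pi_gt0 R.
  by apply: sin_gt0_pi; rewrite mulr_gt0//= gtr_pMr.
have : 0 < sin (pi * a) ^+ 2 by rewrite exprn_gt0.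
by move=> s2; rewrite lt_eqF//; lra.
Qed.

End complex_exponential.

Section lattice_sampling.
Context {R : realType} {d : nat}.
Local Notation Zd := 'rV[int]_d.
Variables (z : Zd) (M : nat).
Hypothesis M0 : (0 < M)%N.
Local Notation pt := (@lattice_point R d z M).

Definition int_dot (k : Zd) : int := \sum_i k ord0 i * z ord0 i.

(** A geometric sum whose ratio is an M-th root of unity. *)
Lemma cis2pi_mean (t : int) :
  (M%:R)^-1 * \sum_(j < M) cis2pi (j%:R / M%:R * t%:~R) =
  (M%:Z %| t)%Z%:R :> R[i].
Proof.
have MR0 : (M%:R : R) != 0 by rewrite pnatr_eq0 -lt0n.
have MC0 : (M%:R : R[i]) != 0 by rewrite pnatr_eq0 -lt0n.
under eq_bigr do rewrite -mulrA cis2piMn.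
case: (boolP (M%:Z %| t)%Z) => [/dvdzP[q ->]|ndiv].
  under eq_bigr do rewrite intrM mulrCA mulVf// mulr1 cis2pi_int expr1n.
  by rewrite sumr_const card_ord mulVf.
have w1 : cis2pi (M%:R^-1 * t%:~R) != 1 :> R[i].
  have -> : cis2pi (M%:R^-1 * t%:~R) = cis2pi (M%:R^-1 * (t %% M)%Z%:~R) :> R[i].
    rewrite {1}(divz_eq t M) intrD intrM mulrDr cis2piD mulrCA mulVf// mulr1.
    by rewrite cis2pi_int mul1r.
  have M1 : M%:Z != 0 by rewrite eqz_nat -lt0n.
  apply: cis2pi_neq1; rewrite mulr_gt0 ?invr_gt0 ?ltr0n//=; last first.
    rewrite ltr0z lt_neqAle modz_ge0// andbT eq_sym.
    by apply: contra ndiv => /eqP/dvdz_mod0P.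
  by rewrite mulrC ltr_pdivrMr ?ltr0n// mul1r -[M%:R]/(M%:Z%:~R) ltr_int ltz_pmod.
have /eqP := subrX1 (cis2pi (M%:R^-1 * t%:~R) : R[i]) M.
rewrite -cis2piMn mulrA mulfV// mul1r cis2pi_int subrr eq_sym mulf_eq0.
by rewrite subr_eq0 (negbTE w1)/= => /eqP ->; rewrite mulr0.
Qed.

(** Reducing the lattice points modulo 1 changes zdot k by an integer. *)
Lemma cis2pi_lattice (k : Zd) j :
  cis2pi (zdot k (pt j)) = cis2pi (j%:R / M%:R * (int_dot k)%:~R) :> R[i].
Proof.
pose q i : int := Num.floor (j%:R / M%:R * (z ord0 i)%:~R + 2^-1 : R).
have -> : zdot k (pt j) = j%:R / M%:R * (int_dot k)%:~R
    + (- \sum_i k ord0 i * q i)%:~R :> R.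
  rewrite /zdot /int_dot !rmorph_sum/= mulr_sumr rmorphN/= rmorph_sum/=.
  rewrite -sumrB; apply: eq_bigr => i _.
  by rewrite !mxE -/(q i) !intrM; ring.
by rewrite cis2piD cis2pi_int mulr1.
Qed.

(** Aliasing: on the lattice, frequencies with the same value of k.z modulo M
    cannot be told apart, and the others are orthogonal. *)
Lemma lattice_ortho (l k : Zd) :
  (M%:R)^-1 * \sum_(j < M) cis2pi (zdot l (pt j)) * cis2pi (- zdot k (pt j)) =
  (M%:Z %| int_dot (l - k))%Z%:R :> R[i].
Proof.
rewrite -cis2pi_mean; congr (_ * _); apply: eq_bigr => j _.
rewrite cis2piN cis2pi_lattice cis2pi_lattice -cis2piN -cis2piD -mulrN -mulrDr.
congr (cis2pi (_ * _)); rewrite -intrN -intrD; congr (_%:~R).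
by rewrite /int_dot -sumrN -big_split/=; apply: eq_bigr => i _; rewrite !mxE mulrDl mulNr.
Qed.

Section aliasing.
Variables (I : seq Zd) (uI : uniq I).
Hypothesis recI : reconstructing z M [set` I].

Let aliased (l : Zd) : seq Zd := [seq k <- I | (M%:Z %| int_dot (l - k))%Z].

Let int_dotB k l : int_dot (k - l) = int_dot k - int_dot l.
Proof.
by rewrite /int_dot -sumrB; apply: eq_bigr => i _; rewrite !mxE mulrBl.
Qed.

Let aliased_eq l k1 k2 : k1 \in aliased l -> k2 \in aliased l -> k1 = k2.
Proof.
rewrite !mem_filter => /andP[d1 I1] /andP[d2 I2].
apply/eqP; rewrite -subr_eq0; apply: contraT => /(recI I1 I2); rewrite -/(int_dot _).
have -> : int_dot (k1 - k2) = int_dot (l - k2) - int_dot (l - k1).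
  by rewrite !int_dotB; ring.
by move=> /negP; case; apply: rpredB.
Qed.

(** At most one frequency of I is an alias of l, by the reconstruction property,
    and it is l itself if l is in I. *)
Lemma aliasing_error (l : Zd) (x : 'rV[R]_d) :
  cabs (cis2pi (zdot l x) -
    \sum_(k <- I) (M%:Z %| int_dot (l - k))%Z%:R * cis2pi (zdot k x)) <=
  (l \notin I)%:R *+ 2.
Proof.
have -> : \sum_(k <- I) (M%:Z %| int_dot (l - k))%Z%:R * cis2pi (zdot k x) =
    \sum_(k <- aliased l) cis2pi (zdot k x) :> R[i].
  rewrite big_filter [RHS]big_mkcond/=; apply: eq_bigr => k _.
  by case: (_ %| _)%Z; rewrite ?mul1r ?mul0r.
have ual : uniq (aliased l) by exact: filter_uniq.
case: (boolP (l \in I)) => lI /=.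
  have lal : l \in aliased l.
    by rewrite mem_filter lI andbT subrr /int_dot big1 ?dvdz0// => i _; rewrite mxE mul0r.
  rewrite (_ : aliased l = [:: l]); first by rewrite big_seq1 subrr cabs0.
  apply: perm_small_eq => //; apply: uniq_perm => // k.
  by rewrite inE; apply/idP/eqP => [/(aliased_eq lal) <- //|->].
rewrite (le_trans (cabsD _ _))// cabsN cabs_cis2pi mulr2n lerD2l.
case E : (aliased l) => [|k [|k' s]]; first by rewrite big_nil cabs0.
  by rewrite big_seq1 cabs_cis2pi.
have kk' : k = k' by apply: (@aliased_eq l); rewrite E !inE eqxx ?orbT.
by move: ual; rewrite E kk' /= inE eqxx.
Qed.

(** Both the polynomial and its lattice approximation are linear in the
    coefficients c, so the errors of the single frequencies add up. *)
Lemma sampling_error (B : seq Zd) (c : Zd -> R[i]) (x : 'rV[R]_d)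
    (F := fun y => \sum_(l <- B) c l * cis2pi (zdot l y)) :
  cabs (F x - \sum_(k <- I) (M%:R^-1 *
     \sum_(j < M) F (pt j) * cis2pi (- zdot k (pt j))) * cis2pi (zdot k x)) <=
  2 * \sum_(l <- B | l \notin I) cabs (c l).
Proof.
have -> : \sum_(k <- I) (M%:R^-1 *
     \sum_(j < M) F (pt j) * cis2pi (- zdot k (pt j))) * cis2pi (zdot k x) =
   \sum_(l <- B) c l * (\sum_(k <- I) (M%:Z %| int_dot (l - k))%Z%:R *
      cis2pi (zdot k x)).
  under [RHS]eq_bigr do rewrite mulr_sumr.
  rewrite exchange_big/=; apply: eq_bigr => k _.
  under eq_bigr do rewrite mulr_suml.
  rewrite exchange_big/= mulr_sumr mulr_suml; apply: eq_bigr => l _.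
  rewrite -lattice_ortho; under eq_bigr do rewrite -mulrA.
  by rewrite -mulr_sumr; ring.
rewrite -sumrB mulr_sumr [leRHS]big_mkcond/=.
apply: le_trans (cabs_sum _ _ _) _; apply: ler_sum => l _.
rewrite -mulrBr cabsM (le_trans (ler_wpM2l (cabs_ge0 _) (aliasing_error l x)))//.
by case: (l \notin I); rewrite ?mul0rn ?mulr0// mulrC.
Qed.

End aliasing.
End lattice_sampling.

(** * Sums over frequencies *)

Section frequency_sums.
Context {R : realType}.

(** Dyadic blocks: the 2^K terms from 2^K on add up to at most q^K with
    q = 2^(1-s) < 1. *)
Lemma zeta_bound (s : R) : 1 < s -> exists Z : R, forall n,
  \sum_(i < n) (maxn 1 i)%:R `^ (- s) <= Z.
Proof.
move=> s1; pose q : R := 2 `^ (1 - s).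
have q0 : 0 < q by rewrite powR_gt0.
have q1 : q < 1.
  rewrite /q -opprB powRN invf_lt1 ?powR_gt0//.
  have : 1 `^ (s - 1) < 2 `^ (s - 1) :> R.
    by apply: gt0_ltr_powR; rewrite ?nnegrE ?subr_gt0// ltr1n.
  by rewrite powR1.
have block K : \sum_(2 ^ K <= i < 2 ^ K.+1) (maxn 1 i)%:R `^ (- s) <= q ^+ K.
  have le i : (2 ^ K <= i)%N -> (maxn 1 i)%:R `^ (- s) <= (2 ^ K)%:R `^ (- s) :> R.
    move=> Ki; rewrite !powRN lef_pV2 ?posrE ?powR_gt0 ?ltr0n ?expn_gt0//.
    - rewrite ge0_ler_powR ?nnegrE//; first by rewrite (le_trans ler01)// ltW.
      by rewrite ler_nat leq_max Ki orbT.
    - by rewrite leq_max.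
  rewrite big_nat; apply: (@le_trans _ _ (\sum_(2 ^ K <= i < 2 ^ K.+1 |
      (2 ^ K <= i < 2 ^ K.+1)%N) (2 ^ K)%:R `^ (- s))).
    by apply: ler_sum => i /andP[Ki _]; exact: le.
  have e1 : (2 ^ K)%:R = 2 `^ K%:R :> R by rewrite natrX powR_mulrn.
  have e2 : q ^+ K = 2 `^ ((1 - s) * K%:R).
    by rewrite -powR_mulrn ?powR_ge0// -powRrM.
  rewrite -big_nat sumr_const_nat expnS mul2n -addnn addnK -[leLHS]mulr_natl e1 e2.
  rewrite -powRrM -powRD ?pnatr_eq0 ?implybT// le_eqVlt; apply/orP; left.
  by apply/eqP; congr (_ `^ _); ring.
exists (1 + (1 - q)^-1) => n.
have mono m : \sum_(i < 2 ^ m) (maxn 1 i)%:R `^ (- s) <= 1 + \sum_(i < m) q ^+ i :> R.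
  elim: m => [|m IH]; first by rewrite expn0 big_ord1 big_ord0 addr0 /= powR1.
  rewrite -(big_mkord xpredT (fun i => (maxn 1 i)%:R `^ (- s) : R)).
  rewrite (@big_cat_nat _ _ _ (2 ^ m))//= ?leq_exp2l// big_mkord.
  by rewrite big_ord_recr/= addrA lerD.
apply: le_trans (le_trans (mono n) _).
  rewrite -(big_mkord xpredT (fun i => (maxn 1 i)%:R `^ (- s) : R)).
  rewrite -[leRHS](big_mkord xpredT (fun i => (maxn 1 i)%:R `^ (- s) : R)).
  rewrite [leRHS](@big_cat_nat _ _ _ n)//=; last exact/ltnW/ltn_expl.
  by rewrite lerDl sumr_ge0// => i _; rewrite powR_ge0.
rewrite lerD2l -[leRHS]mul1r ler_pdivlMr ?subr_gt0// mulrC.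
rewrite -opprB mulNr -subrX1 opprB lerBlDr lerDl exprn_ge0//.
exact: ltW.
Qed.

Section cube.
Context {d : nat}.
Local Notation Zd := 'rV[int]_d.

(** Points of the cube are indexed by a finite type, to expand a product of d
    one-dimensional sums into one sum. *)
Definition cube_point n (f : {ffun 'I_d -> 'I_(n.*2.+1)}) : Zd :=
  \row_i ((f i)%:Z - n%:Z).

Definition cube n : seq Zd := [seq cube_point f | f : {ffun 'I_d -> 'I_(n.*2.+1)}].

Lemma cube_point_inj n : injective (@cube_point n).
Proof.
move=> f g /rowP fg; apply/ffunP => i; apply/val_inj.
by have := fg i; rewrite !mxE => /addIr[].
Qed.

Lemma cube_uniq n : uniq (cube n).
Proof. by rewrite map_inj_uniq ?enum_uniq//; exact: cube_point_inj. Qed.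

Lemma mem_cube n (k : Zd) : (k \in cube n) = [forall i, (`|k ord0 i| <= n)%N].
Proof.
apply/mapP/forallP => [[f _ ->] i|kn].
  rewrite mxE; move: (ltn_ord (f i)); move: (nat_of_ord (f i)) => a.
  by rewrite -addnn; lia.
have lt i : (`|(k ord0 i + n%:Z)%R| < n.*2.+1)%N.
  by move: (kn i); move: (k ord0 i) => a; rewrite -addnn; lia.
exists [ffun i => Ordinal (lt i)]; first by rewrite mem_enum.
by apply/rowP => i; rewrite mxE ffunE /=; move: (kn i); move: (k ord0 i) => a; lia.
Qed.

Lemma cube_sum_prod n (g : int -> R) :
  \sum_(k <- cube n) \prod_i g (k ord0 i) =
  (\sum_(j < n.*2.+1) g (j%:Z - n%:Z)) ^+ d.
Proof.
rewrite big_map big_enum/= -[d in RHS]card_ord -prodr_const.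
rewrite (bigA_distr_bigA (fun (_ : 'I_d) (j : 'I_(n.*2.+1)) =>
  g (j%:Z - n%:Z)))/=.
by apply: eq_bigr => f _; apply: eq_bigr => i _; rewrite mxE.
Qed.

Lemma sum_sym_le n (g : nat -> R) : (forall j, 0 <= g j) ->
  \sum_(j < n.*2.+1) g `|j%:Z - n%:Z|%N <= 2 * \sum_(j < n.+1) g j.
Proof.
move=> g0.
rewrite -(big_mkord xpredT (fun j => g `|j%:Z - n%:Z|%N)).
rewrite (@big_cat_nat _ _ _ n)//=; last by rewrite -addnn leqW// leq_addr.
rewrite mulr_natl mulr2n lerD//.
  rewrite big_nat_rev/= add0n big_mkord big_ord_recl/= addrC.
  rewrite ler_wpDr//; apply: ler_sum => j _; rewrite le_eqVlt; apply/orP; left.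
  by apply/eqP; congr g; move: (ltn_ord j); rewrite ?/bump /=; lia.
rewrite -{1}[n]add0n big_addn -addnn -addSn addnK big_mkord.
by apply: ler_sum => j _; rewrite (_ : absz _ = j)//; lia.
Qed.

Lemma omega_hc_gt0 (k : Zd) : (0 < omega_hc k)%N.
Proof. by rewrite prodn_gt0// => i; rewrite leq_max. Qed.

(** The sum over the cube is the d-th power of a one-dimensional sum. *)
Lemma cube_weight_bound (s : R) : 1 < s -> exists Z : R, forall n,
  \sum_(k <- cube n) (omega_hc k)%:R `^ (- s) <= Z.
Proof.
move=> s1; have [Z Zn] := zeta_bound s1; exists ((2 * Z) ^+ d) => n.
pose g j : R := (maxn 1 j)%:R `^ (- s).
have g0 j : 0 <= g j by exact: powR_ge0.
rewrite (eq_bigr (fun k : Zd => \prod_i g `|k ord0 i|%N)); last first.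
  move=> k _; rewrite /omega_hc natr_prod.
  suff [] : 0 <= \prod_i (maxn 1 `|k ord0 i|)%:R :> R /\
    (\prod_i (maxn 1 `|k ord0 i|)%:R) `^ (- s) = \prod_i g `|k ord0 i|%N by [].
  elim/big_rec2 : _ => [|i x y _ [x0 <-]]; first by rewrite powR1.
  by rewrite powRM// mulr_ge0.
rewrite (cube_sum_prod n (fun j => g `|j|%N)) lerXn2r ?nnegrE//.
- exact: sumr_ge0.
- by rewrite (le_trans _ (le_trans (sum_sym_le n g0) _)) ?sumr_ge0// ler_wpM2l.
- by rewrite (le_trans (sum_sym_le n g0))// ler_wpM2l.
Qed.

Lemma hyperbolic_cross_cube N (k : Zd) : (omega_hc k <= N)%N -> k \in cube N.
Proof.
move=> kN; rewrite mem_cube; apply/forallP => i; apply: leq_trans kN.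
rewrite /omega_hc (bigD1 i)//= (leq_trans (leq_maxr 1 _))// leq_pmulr//.
by rewrite prodn_gt0// => j; rewrite leq_max.
Qed.

End cube.

Lemma cauchy_schwarz_seq (I : Type) (r : seq I) (P : pred I) (a b : I -> R) :
  (\sum_(i <- r | P i) a i * b i) ^+ 2 <=
  (\sum_(i <- r | P i) a i ^+ 2) * (\sum_(i <- r | P i) b i ^+ 2).
Proof.
elim: r => [|i r IH]; first by rewrite !big_nil mul0r expr0n.
rewrite !big_cons; case: ifP => // _; move: IH.
have : 0 <= \sum_(j <- r | P j) a j ^+ 2 by rewrite sumr_ge0// => j _; rewrite sqr_ge0.
have : 0 <= \sum_(j <- r | P j) b j ^+ 2 by rewrite sumr_ge0// => j _; rewrite sqr_ge0.
move: (\sum_(j <- r | P j) a j ^+ 2) (\sum_(j <- r | P j) b j ^+ 2)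
  (\sum_(j <- r | P j) a j * b j) (a i) (b i) => A B S x y B0 A0 SAB.
suff : 2 * S * (x * y) <= A * y ^+ 2 + x ^+ 2 * B by nra.
apply: le_trans (ler_norm _) _; rewrite -ler_sqr ?nnegrE//; last first.
  by rewrite addr_ge0// mulr_ge0// sqr_ge0.
rewrite real_normK ?num_real//.
have : 0 <= (A * y ^+ 2 - x ^+ 2 * B) ^+ 2 by rewrite sqr_ge0.
have : S ^+ 2 * (x * y) ^+ 2 <= A * B * (x * y) ^+ 2 by rewrite ler_wpM2r// sqr_ge0.
by nra.
Qed.

End frequency_sums.

Section sums_over_cubes.
Context {R : realType} {d : nat}.
Local Notation Zd := 'rV[int]_d.

Lemma ler_sum_subset (T : eqType) (s1 s2 : seq T) (P : pred T) (w : T -> R) :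
  uniq s1 -> uniq s2 -> {subset s1 <= s2} -> (forall x, 0 <= w x) ->
  \sum_(x <- s1 | P x) w x <= \sum_(x <- s2) w x.
Proof.
move=> u1 u2 s12 w0.
have /(perm_big _)-> : perm_eq s1 [seq x <- s2 | x \in s1].
  apply: uniq_perm => //; first exact: filter_uniq.
  by move=> x; rewrite mem_filter; case: (boolP (x \in s1)) => //= /s12 ->.
rewrite big_filter_cond big_mkcond; apply: ler_sum => x _.
by case: ifP.
Qed.

Lemma cube_subset n n' : (n <= n')%N -> {subset @cube d n <= cube n'}.
Proof.
move=> nn' k; rewrite !mem_cube => /forallP kn; apply/forallP => i.
exact: leq_trans (kn i) nn'.
Qed.

(** Split u as (`|u| + u) - `|u|: both sums are monotone and bounded. *)
Lemma cube_sum_cvg (u : Zd -> R) (A : R) :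
  (forall n, \sum_(k <- cube n) `|u k| <= A) ->
  cvgn (fun n => \sum_(k <- cube n) u k).
Proof.
move=> uA.
have cv (w : Zd -> R) B : (forall k, 0 <= w k) ->
    (forall n, \sum_(k <- cube n) w k <= B) ->
    cvgn (fun n => \sum_(k <- cube n) w k).
  move=> w0 wB; apply: nondecreasing_is_cvgn.
    move=> n n' nn'; apply: ler_sum_subset => //; first exact: cube_uniq.
      exact: cube_uniq.
    exact: cube_subset.
  by exists B => _ [n _ <-].
have c1 := cv _ A (fun k => normr_ge0 (u k)) uA.
have c2 : cvgn (fun n => \sum_(k <- @cube d n) (`|u k| + u k)).
  apply: (cv _ (A + A)) => [k|n].
    by rewrite -lerBlDr sub0r -normrN ler_norm.
  rewrite big_split lerD// (le_trans _ (uA n))// ler_sum// => k _.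
  exact: ler_norm.
have -> : (fun n => \sum_(k <- cube n) u k) =
    (fun n => \sum_(k <- cube n) (`|u k| + u k)) \- (fun n => \sum_(k <- cube n) `|u k|).
  by apply/funext => n /=; rewrite -sumrB; apply: eq_bigr => k _; rewrite addrC addKr.
exact: is_cvgB.
Qed.

Definition hc_seq N : seq Zd := [seq k <- cube N | (omega_hc k <= N)%N].

Lemma mem_hc_seq N (k : Zd) : (k \in hc_seq N) = (omega_hc k <= N)%N.
Proof.
rewrite mem_filter; case: (boolP (omega_hc k <= N)%N) => //= kN.
exact: hyperbolic_cross_cube.
Qed.

Lemma hc_seq_uniq N : uniq (hc_seq N).
Proof. exact/filter_uniq/cube_uniq. Qed.

Let omega_powR (k : Zd) (m : nat) :
  (omega_hc k)%:R ^- m ^+ 2 = (omega_hc k)%:R `^ (- (2 * m%:R)) :> R.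
Proof.
rewrite exprVn -exprM mulnC powRN; congr (_^-1).
by rewrite -natrM powR_mulrn.
Qed.

(** Cauchy-Schwarz with the weights omega_hc^-m and omega_hc^m. *)
Lemma weighted_sum_le (m : nat) (c : Zd -> R[i]) (S W : R) (r : seq Zd) (P : pred Zd) :
  \sum_(k <- r | P k) (omega_hc k)%:R `^ (- (2 * m%:R)) <= W ->
  \sum_(k <- r) (omega_hc k)%:R ^+ (2 * m) * cabs (c k) ^+ 2 <= S ->
  \sum_(k <- r | P k) cabs (c k) <= Num.sqrt (W * S).
Proof.
move=> hW hS.
have o0 (k : Zd) : (omega_hc k)%:R != 0 :> R.
  by rewrite pnatr_eq0 -lt0n omega_hc_gt0.
have E : \sum_(k <- r | P k) cabs (c k) = \sum_(k <- r | P k)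
    (omega_hc k)%:R ^- m * ((omega_hc k)%:R ^+ m * cabs (c k)).
  by apply: eq_bigr => k _; rewrite mulrA mulVf ?expf_neq0// mul1r.
rewrite -ler_sqr ?nnegrE ?sqrtr_ge0//; last by rewrite sumr_ge0// => k _; exact: cabs_ge0.
have W0 : 0 <= W.
  by apply: le_trans hW; rewrite sumr_ge0// => k _; exact: powR_ge0.
have pos (k : Zd) : 0 <= (omega_hc k)%:R ^+ (2 * m) * cabs (c k) ^+ 2 :> R.
  by rewrite mulr_ge0 ?exprn_ge0 ?cabs_ge0.
have S0 : 0 <= S by apply: le_trans hS; rewrite sumr_ge0.
rewrite sqr_sqrtr ?mulr_ge0// E (le_trans (cauchy_schwarz_seq _ _ _ _))//.
rewrite ler_pM ?sumr_ge0//; do ?[by move=> k _; rewrite sqr_ge0].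
  by apply: le_trans hW; apply: ler_sum => k _; rewrite omega_powR.
apply: le_trans hS; rewrite big_mkcond ler_sum// => k _.
by case: ifP => // _; rewrite exprMn -exprM mulnC.
Qed.

(** Outside the hyperbolic cross, omega_hc^(-2m) is at most N^(2 (mu - m)) times
    omega_hc^(-2 mu), where mu = min lambda m; the latter weight is summable
    because 2 mu > 1. *)
Lemma hyperbolic_tail (m : nat) (lambda : R) : (0 < m)%N -> 2^-1 < lambda ->
  exists2 K : R, 0 < K & forall N n (c : Zd -> R[i]) (S : R), (0 < N)%N ->
    \sum_(k <- cube n) (omega_hc k)%:R ^+ (2 * m) * cabs (c k) ^+ 2 <= S ->
    \sum_(k <- cube n | k \notin hc_seq N) cabs (c k) <=
      K * N%:R `^ (- m%:R + lambda) * Num.sqrt S.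
Proof.
move=> m0 la; pose mu := Num.min lambda m%:R.
have mu2 : 1 < 2 * mu.
  rewrite -ltr_pdivrMl// mulr1 /mu lt_min la/=.
  by rewrite (lt_le_trans (_ : 2^-1 < 1))// ?invf_lt1// ?ltr1n// ler1n.
have mum : mu <= m%:R by rewrite ge_min lexx orbT.
have mula : mu <= lambda by rewrite ge_min lexx.
have [Z Zb] := @cube_weight_bound R d _ mu2.
pose Z1 := Num.max Z 1.
have Z10 : 0 < Z1 by rewrite lt_max ltr01 orbT.
exists (Num.sqrt Z1); first by rewrite sqrtr_gt0.
move=> N n c S N0 hS.
have N1 : 1 <= N%:R :> R by rewrite ler1n.
have NP : 0 < N%:R :> R by rewrite ltr0n.
have W : \sum_(k <- cube n | k \notin hc_seq N)
    (omega_hc k)%:R `^ (- (2 * m%:R)) <= (N%:R `^ (mu - m%:R)) ^+ 2 * Z1 :> R.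
  apply: (@le_trans _ _ (\sum_(k <- @cube d n) (N%:R `^ (mu - m%:R)) ^+ 2 *
      (omega_hc k)%:R `^ (- (2 * mu)))); last first.
    rewrite -mulr_sumr ler_wpM2l ?sqr_ge0//.
    by rewrite (le_trans (Zb n))// le_max lexx.
  rewrite big_mkcond ler_sum// => k _; rewrite mem_hc_seq -ltnNge.
  case: ifPn => [Nk|_]; last by rewrite mulr_ge0 ?sqr_ge0 ?powR_ge0.
  have k0 : 0 < (omega_hc k)%:R :> R by rewrite ltr0n omega_hc_gt0.
  rewrite (_ : - (2 * m%:R) = 2 * (mu - m%:R) + - (2 * mu)); last by ring.
  rewrite (@powRD _ (omega_hc k)%:R); last by rewrite (gt_eqF k0) implybT.
  rewrite ler_wpM2r ?powR_ge0//.
  rewrite -powR_mulrn ?powR_ge0// -powRrM [(mu - _) * _]mulrC.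
  rewrite -opprB mulrN !powRN lef_pV2 ?posrE ?powR_gt0//.
  by rewrite ge0_ler_powR ?nnegrE ?mulr_ge0 ?subr_ge0 ?ler_nat// ltnW.
apply: le_trans (weighted_sum_le W hS) _.
rewrite -mulrA sqrtrM ?sqr_ge0// sqrtr_sqr ger0_norm ?powR_ge0//.
rewrite sqrtrM ?(ltW Z10)// mulrA ler_wpM2r ?sqrtr_ge0// mulrC.
rewrite ler_wpM2l ?sqrtr_ge0// ler_powR//.
by rewrite addrC lerD2l.
Qed.

Lemma absolutely_summable (m : nat) (c : Zd -> R[i]) (S : R) : (0 < m)%N ->
  (forall n, \sum_(k <- cube n) (omega_hc k)%:R ^+ (2 * m) * cabs (c k) ^+ 2 <= S) ->
  exists A, forall n, \sum_(k <- cube n) cabs (c k) <= A.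
Proof.
move=> m0 hS; have [|Z Zb] := @cube_weight_bound R d (2 * m%:R).
  by rewrite -natrM ltr1n mul2n -addnn -addn1 leq_add.
by exists (Num.sqrt (Z * S)) => n; exact: (weighted_sum_le (Zb n) (hS n)).
Qed.

End sums_over_cubes.

Section complex_limits.
Context {R : realType}.

Definition Ccvg (u : nat -> R[i]) (l : R[i]) :=
  complex.Re (u n) @[n --> \oo] --> complex.Re l /\
  complex.Im (u n) @[n --> \oo] --> complex.Im l.

Lemma Ccvg_cst l : Ccvg (fun _ => l) l.
Proof. by split; exact: cvg_cst. Qed.

Lemma CcvgD u v a b : Ccvg u a -> Ccvg v b -> Ccvg (fun n => u n + v n) (a + b).
Proof.
have ReD (z w : R[i]) : complex.Re (z + w) = complex.Re z + complex.Re w.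
  by case: z w => [? ?] [].
have ImD (z w : R[i]) : complex.Im (z + w) = complex.Im z + complex.Im w.
  by case: z w => [? ?] [].
move=> [ua1 ua2] [vb1 vb2]; split.
  by rewrite ReD; under eq_fun do rewrite ReD; exact: cvgD.
by rewrite ImD; under eq_fun do rewrite ImD; exact: cvgD.
Qed.

Lemma Re_mul (z w : R[i]) : complex.Re (z * w) =
  complex.Re z * complex.Re w - complex.Im z * complex.Im w.
Proof. by case: z w => [? ?] []. Qed.

Lemma Im_mul (z w : R[i]) : complex.Im (z * w) =
  complex.Re z * complex.Im w + complex.Im z * complex.Re w.
Proof. by case: z w => [? ?] []. Qed.

Lemma CcvgZ u a c : Ccvg u a -> Ccvg (fun n => c * u n) (c * a).
Proof.
move=> [ua1 ua2]; split.
  rewrite Re_mul; under eq_fun do rewrite Re_mul.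
  by apply: cvgB; apply: cvgMr.
rewrite Im_mul; under eq_fun do rewrite Im_mul.
by apply: cvgD; apply: cvgMr.
Qed.

Lemma Ccvg_sum (I : Type) (r : seq I) (u : I -> nat -> R[i]) (a : I -> R[i]) :
  (forall i, Ccvg (u i) (a i)) ->
  Ccvg (fun n => \sum_(i <- r) u i n) (\sum_(i <- r) a i).
Proof.
move=> ua; elim: r => [|i r IH].
  by rewrite big_nil; under [X in Ccvg X]eq_fun do rewrite big_nil; exact: Ccvg_cst.
rewrite big_cons; under [X in Ccvg X]eq_fun do rewrite big_cons; exact: CcvgD.
Qed.

Lemma Ccvg_cabs_le u a b : Ccvg u a -> (forall n, cabs (u n) <= b) -> cabs a <= b.
Proof.
move=> [ua1 ua2] ub.
have cv : cabs (u n) @[n --> \oo] --> cabs a.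
  have cv2 : complex.Re (u n) ^+ 2 + complex.Im (u n) ^+ 2 @[n --> \oo] -->
      complex.Re a ^+ 2 + complex.Im a ^+ 2.
    by apply: cvgD; rewrite expr2; under eq_fun do rewrite expr2; exact: cvgM.
  exact: (cvg_comp _ _ cv2 (@sqrt_continuous R _)).
by rewrite -(cvg_lim _ cv)//; apply: limr_le; [apply/cvgP: cv|exact: nearW].
Qed.

End complex_limits.

(** * Fourier series and complex integrals *)

Section fourier_series.
Context {R : realType} {d : nat}.
Local Notation Zd := 'rV[int]_d.
Variables (c : Zd -> R[i]) (A : R).
Hypothesis cA : forall n, \sum_(k <- cube n) cabs (c k) <= A.

Definition fourier_partial n (x : 'rV[R]_d) : R[i] :=
  \sum_(k <- cube n) c k * cis2pi (zdot k x).

Definition fourier_sum (x : 'rV[R]_d) : R[i] :=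
  Clim (fun n => fourier_partial n x).

Lemma cabs_fourier_partial n x : cabs (fourier_partial n x) <= A.
Proof.
apply: le_trans (cA n); apply: le_trans (cabs_sum _ _ _) _.
by apply: ler_sum => k _; rewrite cabsM cabs_cis2pi mulr1.
Qed.

Lemma fourier_partial_cvg x : Ccvg (fourier_partial ^~ x) (fourier_sum x).
Proof.
have ub k : cabs (c k * cis2pi (zdot k x)) = cabs (c k).
  by rewrite cabsM cabs_cis2pi mulr1.
split.
  rewrite /fourier_sum /=.
  have -> : (fun n => complex.Re (fourier_partial n x)) =
      (fun n => \sum_(k <- cube n) complex.Re (c k * cis2pi (zdot k x))).
    by apply/funext => n; rewrite Re_sum.
  apply: (@cube_sum_cvg _ _ _ A) => n; apply: le_trans (cA n).
  by apply: ler_sum => k _; rewrite (le_trans (normr_Re _))// ub.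
rewrite /fourier_sum /=.
have -> : (fun n => complex.Im (fourier_partial n x)) =
    (fun n => \sum_(k <- cube n) complex.Im (c k * cis2pi (zdot k x))).
  by apply/funext => n; rewrite Im_sum.
apply: (@cube_sum_cvg _ _ _ A) => n; apply: le_trans (cA n).
by apply: ler_sum => k _; rewrite (le_trans (normr_Im _))// ub.
Qed.

(** The bound for polynomials is uniform in their degree, and survives the limit
    because the lattice rule involves finitely many points. *)
Lemma fourier_sum_sampling_error (z : Zd) M (I : seq Zd) b x :
  (0 < M)%N -> uniq I -> reconstructing z M [set` I] ->
  (forall n, \sum_(l <- cube n | l \notin I) cabs (c l) <= b) ->
  cabs (fourier_sum x - \sum_(k <- I) (M%:R^-1 *
     \sum_(j < M) fourier_sum (lattice_point z M j) *
       cis2pi (- zdot k (lattice_point z M j))) * cis2pi (zdot k x)) <= 2 * b.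
Proof.
move=> M0 uI recI tail.
apply: (@Ccvg_cabs_le _ (fun n => fourier_partial n x - \sum_(k <- I) (M%:R^-1 *
     \sum_(j < M) fourier_partial n (lattice_point z M j) *
       cis2pi (- zdot k (lattice_point z M j))) * cis2pi (zdot k x))); last first.
  move=> n; apply: le_trans (sampling_error M0 uI recI (cube n) c x) _.
  by rewrite ler_wpM2l.
apply: CcvgD; first exact: fourier_partial_cvg.
rewrite -mulN1r; under [X in Ccvg X]eq_fun do rewrite -mulN1r.
apply: CcvgZ; apply: Ccvg_sum => k.
rewrite mulrC mulrA; under [X in Ccvg X]eq_fun do rewrite mulrC mulrA.
apply: CcvgZ; apply: Ccvg_sum => j.
rewrite mulrC; under [X in Ccvg X]eq_fun do rewrite mulrC.
by apply: CcvgZ; exact: fourier_partial_cvg.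
Qed.

End fourier_series.

Section complex_integral.
Context d (T : measurableType d) {R : realType} (mu : {measure set T -> \bar R}).
Implicit Types (f g : T -> R[i]) (c : R[i]).

Definition Cintegrable f :=
  mu.-integrable setT (EFin \o (fun y => complex.Re (f y))) /\
  mu.-integrable setT (EFin \o (fun y => complex.Im (f y))).

Local Notation Cint := (Cintegral mu setT).

Lemma CintegrableD f g : Cintegrable f -> Cintegrable g ->
  Cintegrable (fun y => f y + g y).
Proof.
move=> [f1 f2] [g1 g2]; split.
  apply: eq_integrable (integrableD _ f1 g1) => // y _ /=.
  by case: (f y) (g y) => [? ?] [].
apply: eq_integrable (integrableD _ f2 g2) => // y _ /=.
by case: (f y) (g y) => [? ?] [].
Qed.

Lemma CintegralD f g : Cintegrable f -> Cintegrable g ->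
  Cint (fun y => f y + g y) = Cint f + Cint g.
Proof.
move=> [f1 f2] [g1 g2]; apply/eqP; rewrite eq_complex /Cintegral /=.
rewrite -!RintegralD//; apply/andP; split; apply/eqP; apply: eq_Rintegral => y _;
  by case: (f y) (g y) => [? ?] [].
Qed.

Lemma CintegrableZ c f : Cintegrable f -> Cintegrable (fun y => c * f y).
Proof.
move=> [f1 f2]; split.
  apply: eq_integrable (integrableB _ (integrableZl measurableT (complex.Re c) f1)
    (integrableZl measurableT (complex.Im c) f2)) => // y _ /=.
  by rewrite Re_mul.
apply: eq_integrable (integrableD _ (integrableZl measurableT (complex.Re c) f2)
    (integrableZl measurableT (complex.Im c) f1)) => // y _ /=.
by rewrite Im_mul.
Qed.

Let integrable_scale a (g : T -> R) : mu.-integrable setT (EFin \o g) ->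
  mu.-integrable setT (EFin \o (fun y => a * g y)).
Proof. by move=> ig; exact: eq_integrable (integrableZl measurableT a ig). Qed.

Lemma CintegralZ c f : Cintegrable f -> Cint (fun y => c * f y) = c * Cint f.
Proof.
move=> [f1 f2]; apply/eqP; rewrite eq_complex Re_mul Im_mul /Cintegral /=.
rewrite -!RintegralZl//.
rewrite -RintegralB//; do ?exact: integrable_scale.
rewrite -RintegralD//; do ?exact: integrable_scale.
by apply/andP; split; apply/eqP; apply: eq_Rintegral => y _; rewrite ?Re_mul ?Im_mul.
Qed.

Lemma Cintegrable0 : Cintegrable (fun _ => 0).
Proof. by split; exact: integrable0. Qed.

Lemma Cintegral_sum (I : Type) (r : seq I) (f : I -> T -> R[i]) :
  (forall i, Cintegrable (f i)) ->
  Cintegrable (fun y => \sum_(i <- r) f i y) /\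
  Cint (fun y => \sum_(i <- r) f i y) = \sum_(i <- r) Cint (f i).
Proof.
move=> fi; elim: r => [|i r [IH1 IH2]].
  under eq_fun do rewrite big_nil; split; first exact: Cintegrable0.
  by rewrite big_nil /Cintegral /Rintegral !integral0_eq.
under eq_fun do rewrite big_cons; split; first exact: CintegrableD.
by rewrite big_cons CintegralD// IH2.
Qed.

(** The modulus dominates both the real and the imaginary parts. *)
Lemma Cintegral_cvg (u : nat -> T -> R[i]) (f : T -> R[i]) (g : T -> R) :
  (forall n, Cintegrable (u n)) ->
  mu.-integrable setT (EFin \o g) ->
  (forall n y, cabs (u n y) <= g y) -> (forall y, Ccvg (u ^~ y) (f y)) ->
  Cintegrable f /\ Ccvg (fun n => Cint (u n)) (Cint f).
Proof.
move=> iu ig ug uf.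
have mE (h : T -> R) : measurable_fun [set: T] h ->
  measurable_fun [set: T] (EFin \o h) by move=> mh; exact/measurable_EFinP.
have fcvg (h : nat -> R) l : h n @[n --> \oo] --> l ->
    (h n)%:E @[n --> \oo] --> l%:E by move=> hl; apply: cvg_EFin => //; exact: nearW.
have dom (p : R[i] -> R) : (forall z, `|p z| <= cabs z) ->
    (forall n, mu.-integrable setT (EFin \o (p \o u n))) ->
    (forall y, p (u n y) @[n --> \oo] --> p (f y)) ->
    mu.-integrable setT (EFin \o (p \o f)) /\
    \int[mu]_y p (u n y) @[n --> \oo] --> \int[mu]_y p (f y).
  move=> pz ip cp.
  have mp : measurable_fun [set: T] (p \o f).
    apply: (measurable_fun_cvg (h := fun n => p \o u n)) => [n|y _]; last exact: cp.
    by apply/measurable_EFinP; exact: measurable_int (ip n).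
  have [i1 _ c1] := @dominated_convergence _ _ _ mu setT measurableT
    (fun n => EFin \o (p \o u n)) (EFin \o (p \o f)) (EFin \o g)
    (fun n => measurable_int _ (ip n)) (mE _ mp)
    (aeW _ (fun y _ => fcvg _ _ (cp y))) ig
    (aeW _ (fun y n _ => le_trans (pz (u n y)) (ug n y))).
  split=> //; apply: fine_cvg; move: c1; rewrite fineK//.
  exact: integrable_fin_num.
have [i1 c1] := dom (@complex.Re R) (@normr_Re R) (fun n => (iu n).1)
  (fun y => (uf y).1).
have [i2 c2] := dom (@complex.Im R) (@normr_Im R) (fun n => (iu n).2)
  (fun y => (uf y).2).
by split.
Qed.

End complex_integral.

(** * Fourier coefficients on R^d *)

Section unit_interval_characters.
Context {R : realType}.
Local Notation leb := (@lebesgue_measure R).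

Lemma cos_int (k : int) : cos (2 * pi * k%:~R) = 1 :> R.
Proof. by have [] := @cis2pi_int R k. Qed.

Lemma sin_int (k : int) : sin (2 * pi * k%:~R) = 0 :> R.
Proof. by have [] := @cis2pi_int R k. Qed.

(** The antiderivative takes the same increment 1 over a period, unless k = 0. *)
Lemma integral_unit_itv_1Dcos (k : int) (al : R) :
  (\int[leb]_(x in unit_itv) (1 + cos (2 * pi * (k%:~R * x) + al))%:E =
   (1 + cos al *+ (k == 0))%:E)%E.
Proof.
pose a : R := 2 * pi * k%:~R.
have aE x : 2 * pi * (k%:~R * x) = a * x by rewrite mulrA.
under eq_integral do rewrite aE.
have cont : continuous (fun x : R => 1 + cos (a * x + al)).
  move=> x; apply: cvgD; first exact: cvg_cst.
  apply: continuous_comp; last exact: continuous_cos.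
  by apply: cvgD; [apply: cvgMr; exact: cvg_id|exact: cvg_cst].
rewrite /unit_itv -(@integral_itv_bndoo _ _ _ _ true false); last first.
  by apply/measurable_EFinP/measurable_funTS; exact: continuous_measurable_fun.
have ab : - 2^-1 < 2^-1 :> R by lra.
pose F x : R := if k == 0 then x + x * cos al else x + a^-1 * sin (a * x + al).
have dF (x : R) : is_derive x 1 F (1 + cos (a * x + al)).
  rewrite /F; case: eqP => [k0|/eqP k0].
    by apply: is_derive_eq; rewrite /a k0 mulr0 mul0r add0r /GRing.scale /=; ring.
  have a0 : a != 0 by rewrite !mulf_neq0 ?intr_eq0// gt_eqF// pi_gt0.
  have h : is_derive x 1 (fun x : R => a * x + al) a.
    by apply: is_derive_eq; rewrite /GRing.scale /=; ring.
  have s := @is_derive1_comp R sin (fun x : R => a * x + al) x _ _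
    (is_derive_sin (a * x + al)) h.
  apply: (@is_derive_eq _ _ _ (fun x : R => x + a^-1 *: (sin \o (fun x => a * x + al)) x)).
  by rewrite /GRing.scale /=; field.
have cF : continuous F.
  move=> x; apply: differentiable_continuous; apply/derivable1_diffP.
  by have [] := dF x.
rewrite (@continuous_FTC2 _ _ F)//.
- rewrite -EFinB; congr EFin; rewrite /F; case: eqP => [k0|/eqP k0].
    by rewrite mulr1n; field.
  rewrite mulr0n addr0.
  have -> : sin (a * 2^-1 + al) = sin (a * - 2^-1 + al).
    rewrite (_ : a * 2^-1 + al = (a * - 2^-1 + al) + a); last by field.
    by rewrite (sinD _ a) cos_int sin_int mulr1 mulr0 addr0.
  by lra.
- exact: continuous_subspaceT.
- split.
  + by move=> y _; have [] := dF y.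
  + exact/cvg_at_right_filter/cF.
  + exact/cvg_at_left_filter/cF.
- by move=> x _; rewrite derive1E; have [_ ->] := dF x.
Qed.

End unit_interval_characters.

Section multivariate_transformation.
Context {R : realType} {d : nat}.
Local Notation Rd := 'rV[R]_d.
Local Notation leb := (@lebesgue_Rn R d).
Variables (psi om : 'I_d -> R -> R).
Hypotheses (psiT : forall i, is_transformation (psi i))
  (rhoC : forall i, continuous (density (psi i)))
  (omW : forall i, is_weight (om i)).

Let xi i := transformation_inv (psi i).

Lemma mdensity_gt0 y : 0 < mdensity psi y.
Proof. by rewrite /mdensity prodr_gt0// => i _; exact: density_gt0. Qed.

Lemma mweight_ge0 y : 0 <= mweight om y.
Proof. by rewrite /mweight prodr_ge0// => i _; have [_] := omW i; apply. Qed.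

Lemma measurable_mdensity : measurable_fun [set: Rd] (mdensity psi).
Proof. exact: (measurable_row_prod (fun i => measurable_density (@rhoC i))). Qed.

Lemma measurable_mweight : measurable_fun [set: Rd] (mweight om).
Proof. exact: (measurable_row_prod (fun i => (omW i).1)). Qed.

Lemma measurable_transformation_inv i : measurable_fun [set: R] (xi i).
Proof.
apply: continuous_measurable_fun.
exact: (transformation_inv_continuous (psiT i) (@rhoC i)).
Qed.

Lemma mtransformK (x : Rd) : (forall i, unit_itv (x ord0 i)) ->
  mtransform_inv psi (mtransform psi x) = x.
Proof.
by move=> Qx; apply/rowP => i; rewrite !mxE transformationK.
Qed.

Lemma mdensity_transform (x : Rd) : (forall i, unit_itv (x ord0 i)) ->
  mdensity psi (mtransform psi x) = (mtransform_deriv psi x)^-1.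
Proof.
move=> Qx; rewrite /mtransform_deriv -prodfV; apply: eq_bigr => i _.
by rewrite mxE densityE.
Qed.

Lemma ge0_integral_mtransform (G : Rd -> \bar R) : measurable_fun [set: Rd] G ->
  (forall y, (0 <= G y)%E) ->
  (\int[leb]_(x in [set x : Rd | forall i, unit_itv (x ord0 i)])
     G (mtransform psi x) = \int[leb]_y (G y * (mdensity psi y)%:E))%E.
Proof.
move=> mG G0.
rewrite -(@ge0_integral_row_map _ _ (fun i => transformation_ext (psi i))
  (fun _ => \1_unit_itv) (fun i => density (psi i)))//.
- rewrite integral_mkcond; apply: eq_integral => x _; rewrite patchE.
  case: ifPn => [|/negP]; rewrite inE /= => Qx.
    rewrite big1 ?mule1 => [|i _]; last by rewrite indicE mem_set.
    congr G; apply/rowP => i; rewrite !mxE /transformation_ext patchE mem_set//.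
  have [i nUx] : exists i, ~ unit_itv (x ord0 i) by exact/existsNP.
  by rewrite (bigD1 i)//= indicE memNset// mul0r mule0.
- by move=> i; exact: measurable_transformation_ext.
- by move=> i; apply: measurable_indic; exact: measurable_unit_itv.
- by move=> i; exact: measurable_density.
- by move=> i y; exact/ltW/density_gt0.
move=> i H mH H0; rewrite -(ge0_integral_transformation (psiT i) (@rhoC i) mH H0) [RHS]integral_mkcond.
apply: eq_integral => x _; rewrite patchE indicE /transformation_ext patchE.
by case: ifPn => _; rewrite ?mule1 ?mule0.
Qed.

(** Both sides are, by definition, differences of the integrals of positive and
    negative parts. *)
Lemma integral_mtransform (G : Rd -> R) : measurable_fun [set: Rd] G ->
  \int[leb]_(x in [set x : Rd | forall i, unit_itv (x ord0 i)])
     G (mtransform psi x) = \int[leb]_y (G y * mdensity psi y).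
Proof.
move=> mG; rewrite /Rintegral; congr fine.
have mGE : measurable_fun [set: Rd] (EFin \o G) by exact/measurable_EFinP.
rewrite [LHS]integralE [RHS]integralE; congr (_ - _)%E.
- rewrite (_ : (fun y => (G y * mdensity psi y)%:E)^\+ =
      (fun y => (EFin \o G)^\+ y * (mdensity psi y)%:E))%E.
    rewrite -(ge0_integral_mtransform (measurable_funepos mGE)
      (fun y => funepos_ge0 _ y)).
    by apply: eq_integral => y _; rewrite !funeposE.
  apply/funext => y; rewrite !funeposE /= -!EFin_max -EFinM; congr EFin.
  by rewrite maxr_pMl ?mul0r// ltW// mdensity_gt0.
- rewrite (_ : (fun y => (G y * mdensity psi y)%:E)^\- =
      (fun y => (EFin \o G)^\- y * (mdensity psi y)%:E))%E.
    rewrite -(ge0_integral_mtransform (measurable_funeneg mGE)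
      (fun y => funeneg_ge0 _ y)).
    by apply: eq_integral => y _; rewrite !funenegE.
  apply/funext => y; rewrite !funenegE /= -!EFin_max -EFinM; congr EFin.
  by rewrite maxr_pMl ?mul0r ?mulNr// ltW// mdensity_gt0.
Qed.

Lemma integral_mdensity_1Dcos (k : 'rV[int]_d) al :
  (\int[leb]_y ((1 + cos (2 * pi * zdot k (mtransform_inv psi y) + al)) *
     mdensity psi y)%:E = (1 + cos al *+ (k == 0))%:E)%E.
Proof.
have E i (j : int) b : (\int[lebesgue_measure]_y
    ((1 + cos (2 * pi * (j%:~R * xi i y) + b)) * density (psi i) y)%:E =
    (1 + cos b *+ (j == 0))%:E)%E.
  rewrite -integral_unit_itv_1Dcos.
  under eq_integral do rewrite EFinM.
  have m1 : measurable_fun [set: R]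
      (fun y => (1 + cos (2 * pi * (j%:~R * xi i y) + b))%:E).
    apply/measurable_EFinP; apply: measurable_funD => //.
    apply: (measurableT_comp (continuous_measurable_fun (@continuous_cos R))).
    apply: measurable_funD => //; apply: measurable_funM => //.
    by apply: measurable_funM => //; exact: measurable_transformation_inv.
  rewrite -(@ge0_integral_transformation _ _ (psiT i) (@rhoC i) _ m1)//.
    apply: eq_integral => x; rewrite inE => Ux.
    by rewrite /xi transformationK.
have rho1 i : (\int[lebesgue_measure]_y (density (psi i) y)%:E = 1)%E.
  have := E i 0 (pi / 2); rewrite cos_pihalf mul0rn addr0 => <-.
  apply: eq_integral => y _.
  by rewrite mul0r mulr0 add0r cos_pihalf addr0 mul1r.
have := @integral_row_1Dcos R d xi (fun i => density (psi i)) (k ord0)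
  measurable_transformation_inv (fun i => measurable_density (@rhoC i))
  (fun i y => ltW (density_gt0 (psiT i) (@rhoC i) y)) rho1
  (fun i b => E i (k ord0 i) b) al.
have -> : [forall i, k ord0 i == 0] = (k == 0).
  apply/forallP/eqP => [k0|-> i]; last by rewrite mxE.
  by apply/rowP => i; rewrite mxE; exact/eqP.
move=> <-; apply: eq_integral => y _.
by congr (((1 + cos (_ * _ + _)) * _)%:E); apply: eq_bigr => i _; rewrite mxE.
Qed.

Lemma integral_mdensity : (\int[leb]_y (mdensity psi y)%:E = 1)%E.
Proof.
have := integral_mdensity_1Dcos 0 (pi / 2).
rewrite cos_pihalf mul0rn addr0 => <-; apply: eq_integral => y _.
have -> : zdot (0 : 'rV[int]_d) (mtransform_inv psi y) = 0.
  by rewrite /zdot big1// => i _; rewrite mxE mul0r.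
by rewrite mulr0 add0r cos_pihalf addr0 mul1r.
Qed.

Lemma integrable_mdensity : leb.-integrable setT (EFin \o mdensity psi).
Proof.
apply/integrableP; split.
  by apply/measurable_EFinP; exact: measurable_mdensity.
rewrite (eq_integral (fun y => (mdensity psi y)%:E)) ?integral_mdensity ?ltry//.
by move=> y _; rewrite /= ger0_norm// ltW// mdensity_gt0.
Qed.

Lemma measurable_phase (k : 'rV[int]_d) al : measurable_fun [set: Rd]
  (fun y => cos (2 * pi * zdot k (mtransform_inv psi y) + al)).
Proof. exact: (@measurable_char_cos R d xi measurable_transformation_inv). Qed.

(** All integrals being finite, the 1 added to the cosine is subtracted again. *)
Lemma integral_mdensity_cos (k : 'rV[int]_d) al :
  leb.-integrable setT (fun y =>
    (cos (2 * pi * zdot k (mtransform_inv psi y) + al) * mdensity psi y)%:E) /\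
  \int[leb]_y (cos (2 * pi * zdot k (mtransform_inv psi y) + al) * mdensity psi y)
    = cos al *+ (k == 0).
Proof.
have ic : leb.-integrable setT (fun y =>
    (cos (2 * pi * zdot k (mtransform_inv psi y) + al) * mdensity psi y)%:E).
  apply: (le_integrable measurableT _ _ integrable_mdensity).
    apply/measurable_EFinP; apply: measurable_funM; last exact: measurable_mdensity.
    exact: measurable_phase.
  move=> y _ /=; rewrite lee_fin normrM -[leRHS]mul1r ler_wpM2r//.
  by rewrite ler_norml cos_geN1 cos_le1.
split=> //; have := integral_mdensity_1Dcos k al.
under eq_integral do rewrite mulrDl mul1r EFinD.
rewrite integralD//=; last exact: integrable_mdensity.
rewrite integral_mdensity /Rintegral => h; apply: (@addrI _ 1).
move: h; rewrite -[X in (1 + X)%E]fineK; last exact: integrable_fin_num.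
by rewrite -EFinD => -[].
Qed.

End multivariate_transformation.

Section expansion.
Context {R : realType} {d : nat}.
Local Notation Rd := 'rV[R]_d.
Local Notation Zd := 'rV[int]_d.
Local Notation leb := (@lebesgue_Rn R d).
Variables (psi om : 'I_d -> R -> R).
Hypotheses (psiT : forall i, is_transformation (psi i))
  (rhoC : forall i, continuous (density (psi i)))
  (omW : forall i, is_weight (om i)).
Variable h : Rd -> R[i].
Hypothesis hL2 : L2_weighted (mweight om) h.

Let rho := mdensity psi.
Let w := mweight om.
Let xi := mtransform_inv psi.
Let rho_gt0 y : 0 < rho y. Proof. exact: mdensity_gt0. Qed.
Let w_ge0 y : 0 <= w y. Proof. exact: mweight_ge0. Qed.
Let mrho : measurable_fun [set: Rd] rho. Proof. exact: measurable_mdensity. Qed.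
Let mw : measurable_fun [set: Rd] w. Proof. exact: measurable_mweight. Qed.

(** h times the square root of the weights, whose integrals against the
    characters are the Fourier coefficients of h. *)
Definition weighted_fun (y : Rd) : R[i] := h y * (Num.sqrt (w y * rho y))%:C%C.
Local Notation H := weighted_fun.

Let sqrt_div_mul (y : Rd) : Num.sqrt (w y / rho y) * rho y = Num.sqrt (w y * rho y).
Proof.
rewrite -[X in _ * X](ger0_norm (ltW (rho_gt0 y))) -sqrtr_sqr.
rewrite -sqrtrM ?divr_ge0// ?ltW//; congr Num.sqrt.
by rewrite expr2 mulrA divfK// gt_eqF.
Qed.

Let sqrt_inv_mul (y : Rd) : Num.sqrt (rho y / w y) * w y = Num.sqrt (w y * rho y).
Proof.
have [w0|w0] := eqVneq (w y) 0; first by rewrite w0 mulr0 mul0r sqrtr0.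
rewrite -[X in _ * X](ger0_norm (w_ge0 y)) -sqrtr_sqr.
rewrite -sqrtrM ?divr_ge0// ?ltW//; congr Num.sqrt.
by rewrite expr2 mulrA divfK// mulrC.
Qed.

Lemma fourier_coefE k : fourier_coef psi om h k =
  Cintegral leb setT (fun y => H y * cis2pi (- zdot k (xi y))).
Proof.
congr Cintegral; apply/funext => y.
have conjM (a b : R[i]) : conjc (a * b) = conjc a * conjc b by rewrite rmorphM.
rewrite /phi conjM conjc_real -cis2piN -/(rho y) -/(w y) -/(xi y).
by rewrite /H -sqrt_inv_mul rmorphM/=; ring.
Qed.

Let mxi (k : Zd) al : measurable_fun [set: Rd] (fun y => cos (2 * pi * zdot k (xi y) + al)).
Proof. exact: measurable_phase. Qed.

Let mcis (k : Zd) : Cmeasurable (fun y => cis2pi (- zdot k (xi y)) : R[i]).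
Proof.
split => /=.
  by under eq_fun do rewrite mulrN cosN -[_ * _]addr0; exact: mxi.
under eq_fun do rewrite mulrN -cosBpihalf -[X in cos X]opprK cosN opprB opprK addrC.
exact: mxi.
Qed.

Let CmeasurableM (f g : Rd -> R[i]) : Cmeasurable f -> Cmeasurable g ->
  Cmeasurable (fun y => f y * g y).
Proof.
move=> [f1 f2] [g1 g2]; split.
  by under eq_fun do rewrite Re_mul; apply: measurable_funB; exact: measurable_funM.
by under eq_fun do rewrite Im_mul; apply: measurable_funD; exact: measurable_funM.
Qed.

Let Cmeasurable_real (r : Rd -> R) : measurable_fun [set: Rd] r ->
  Cmeasurable (fun y => (r y)%:C%C).
Proof. by move=> mr; split => //=; exact: measurable_cst. Qed.

Let msqrt : measurable_fun [set: R] (@Num.sqrt R).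
Proof. by apply: continuous_measurable_fun; exact: sqrt_continuous. Qed.

(** The change of variables y = psi x. *)
Lemma torus_coefE k : torus_coef (transformed psi om h) k = fourier_coef psi om h k.
Proof.
rewrite fourier_coefE.
pose g (y : Rd) : R[i] := h y * (Num.sqrt (w y / rho y))%:C%C * cis2pi (- zdot k (xi y)).
have mg : Cmeasurable g.
  apply: CmeasurableM => //; apply: CmeasurableM; first exact: hL2.1.1.
  apply: Cmeasurable_real; apply: (measurableT_comp msqrt).
  apply: measurable_funM => //.
  have -> : (fun y => (rho y)^-1) = (fun y => rho y `^ (-1)).
    by apply/funext => y; rewrite powR_inv1 ?ltW.
  exact: (measurableT_comp (@measurable_powR R (-1))).
have gE (x : Rd) : (forall i, unit_itv (x ord0 i)) ->
    transformed psi om h x * cis2pi (- zdot k x) = g (mtransform psi x).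
  move=> Qx; rewrite /g /transformed /xi /rho mtransformK// mdensity_transform//.
  by rewrite invrK.
have ReMr (a : R[i]) (r : R) : complex.Re a * r = complex.Re (a * r%:C%C).
  by rewrite Re_mul mulr0 subr0.
have ImMr (a : R[i]) (r : R) : complex.Im a * r = complex.Im (a * r%:C%C).
  by rewrite Im_mul mulr0 add0r.
have gH y : g y * (rho y)%:C%C = H y * cis2pi (- zdot k (xi y)).
  by rewrite /g /H -sqrt_div_mul rmorphM/=; ring.
rewrite /torus_coef /Cintegral; congr Complex.
  transitivity (\int[leb]_(x in [set x : Rd | forall i, unit_itv (x ord0 i)])
     (fun y => complex.Re (g y)) (mtransform psi x)).
    by apply: eq_Rintegral => x; rewrite inE => Qx; rewrite gE.
  rewrite (integral_mtransform psiT rhoC mg.1).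
  by apply: eq_Rintegral => y _; rewrite /= ReMr gH.
transitivity (\int[leb]_(x in [set x : Rd | forall i, unit_itv (x ord0 i)])
   (fun y => complex.Im (g y)) (mtransform psi x)).
  by apply: eq_Rintegral => x; rewrite inE => Qx; rewrite gE.
rewrite (integral_mtransform psiT rhoC mg.2).
by apply: eq_Rintegral => y _; rewrite /= ImMr gH.
Qed.

Let measurable_cabs (f : Rd -> R[i]) : Cmeasurable f ->
  measurable_fun [set: Rd] (fun y => cabs (f y)).
Proof.
move=> [f1 f2]; apply: (measurableT_comp msqrt).
by apply: measurable_funD; exact: measurable_funX.
Qed.

Let Cintegrable_le (f : Rd -> R[i]) (g : Rd -> R) : Cmeasurable f ->
  leb.-integrable setT (EFin \o g) -> (forall y, cabs (f y) <= g y) ->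
  Cintegrable leb f.
Proof.
move=> [f1 f2] ig fg; split; apply: (le_integrable measurableT _ _ ig).
- exact/measurable_EFinP.
- move=> y _; rewrite /= lee_fin (le_trans (normr_Re _))//.
  by rewrite (le_trans (fg y))// ler_norm.
- exact/measurable_EFinP.
- move=> y _; rewrite /= lee_fin (le_trans (normr_Im _))//.
  by rewrite (le_trans (fg y))// ler_norm.
Qed.

Let irho : leb.-integrable setT (EFin \o rho).
Proof. exact: integrable_mdensity. Qed.

Let mH : Cmeasurable H.
Proof.
apply: CmeasurableM; first exact: hL2.1.1.
apply: Cmeasurable_real; apply: (measurableT_comp msqrt).
exact: measurable_funM.
Qed.

(** |h| sqrt (w rho) <= |h|^2 w + rho, and rho integrates to 1. *)
Lemma Cintegrable_weighted (k : Zd) :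
  Cintegrable leb (fun y => H y * cis2pi (- zdot k (xi y))).
Proof.
apply: (@Cintegrable_le _ (fun y => cabs (h y) ^+ 2 * w y + rho y)).
- exact: CmeasurableM.
- apply: eq_integrable (integrableD measurableT (_ : leb.-integrable setT
    (fun y => (cabs (h y) ^+ 2 * w y)%:E)) irho) => //.
  apply/integrableP; split.
    apply/measurable_EFinP; apply: measurable_funM => //.
    by apply: measurable_funX; apply: measurable_cabs; exact: hL2.1.1.
  rewrite (eq_integral (fun y => (cabs (h y) ^+ 2 * w y)%:E)); first exact: hL2.2.
  by move=> y _; rewrite /= ger0_norm// mulr_ge0// sqr_ge0.
- move=> y; rewrite !cabsM cabs_cis2pi mulr1 cabs_real ger0_norm ?sqrtr_ge0//.
  rewrite sqrtrM//; move: (cabs_ge0 (h y)) => a0.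
  have s0 : 0 <= Num.sqrt (w y) by rewrite sqrtr_ge0.
  have r0 : 0 <= Num.sqrt (rho y) by rewrite sqrtr_ge0.
  rewrite -[X in _ <= _ * X + _](sqr_sqrtr (w_ge0 y)).
  rewrite -[X in _ <= _ + X](sqr_sqrtr (ltW (rho_gt0 y))) -exprMn mulrA.
  move: (cabs (h y) * _) (Num.sqrt (rho y)) => p q.
  have : 0 <= (p - q) ^+ 2 by rewrite sqr_ge0.
  have : 0 <= p ^+ 2 by rewrite sqr_ge0.
  have : 0 <= q ^+ 2 by rewrite sqr_ge0.
  by nra.
Qed.

Lemma Cintegral_character (l : Zd) :
  Cintegrable leb (fun y => cis2pi (zdot l (xi y)) * (rho y)%:C%C) /\
  Cintegral leb setT (fun y => cis2pi (zdot l (xi y)) * (rho y)%:C%C) =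
    (l == 0)%:R.
Proof.
have ReE y : complex.Re (cis2pi (zdot l (xi y)) * (rho y)%:C%C) =
    cos (2 * pi * zdot l (xi y) + 0) * rho y.
  by rewrite Re_mul /= mulr0 subr0 addr0.
have ImE y : complex.Im (cis2pi (zdot l (xi y)) * (rho y)%:C%C) =
    cos (2 * pi * zdot l (xi y) + - (pi / 2)) * rho y.
  by rewrite Im_mul /= mulr0 add0r cosBpihalf.
have [i1 e1] := integral_mdensity_cos psiT rhoC l 0.
have [i2 e2] := integral_mdensity_cos psiT rhoC l (- (pi / 2)).
split; first split.
- by apply: eq_integrable i1 => // y _; rewrite /= -ReE.
- by apply: eq_integrable i2 => // y _; rewrite /= -ImE.
apply/eqP; rewrite eq_complex /Cintegral; apply/andP; split; apply/eqP.
  transitivity (\int[leb]_y (cos (2 * pi * zdot l (xi y) + 0) * rho y)).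
    by apply: eq_Rintegral => y _; exact: ReE.
  by rewrite e1 cos0; case: (l == 0).
transitivity (\int[leb]_y (cos (2 * pi * zdot l (xi y) + - (pi / 2)) * rho y)).
  by apply: eq_Rintegral => y _; exact: ImE.
by rewrite e2 cosN cos_pihalf mul0rn; case: (l == 0).
Qed.

Variable A : R.
Let c := fourier_coef psi om h.
Hypothesis cA : forall n, \sum_(k <- cube n) cabs (c k) <= A.
Local Notation F := (fourier_sum c).

(** For the partial sums this is the orthogonality of the characters; they are
    dominated by A * rho. *)
Lemma Cintegral_fourier_sum (k : Zd) :
  let f y := F (xi y) * (rho y)%:C%C * cis2pi (- zdot k (xi y)) in
  Cintegrable leb f /\ Cintegral leb setT f = c k.
Proof.
move=> f.
pose u n y := fourier_partial c n (xi y) * (rho y)%:C%C * cis2pi (- zdot k (xi y)).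
have uE n : u n = (fun y => \sum_(l <- cube n)
    c l * (cis2pi (zdot (l - k) (xi y)) * (rho y)%:C%C)).
  apply/funext => y; rewrite /u /fourier_partial !mulr_suml; apply: eq_bigr => l _.
  have -> : zdot (l - k) (xi y) = zdot l (xi y) + - zdot k (xi y).
    rewrite /zdot -sumrN -big_split/=; apply: eq_bigr => i _.
    by rewrite !mxE intrD intrN mulrDl mulNr.
  by rewrite cis2piD; ring.
have ul l := CintegrableZ (c l) (Cintegral_character (l - k)).1.
have iu n : Cintegrable leb (u n).
  by rewrite uE; have [] := Cintegral_sum (cube n) ul.
have cu n : k \in cube n -> Cintegral leb setT (u n) = c k.
  move=> kn; rewrite uE; have [_ ->] := Cintegral_sum (cube n) ul.
  rewrite (bigD1_seq k)//= ?cube_uniq// big1 => [|l lk].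
    by rewrite CintegralZ ?(Cintegral_character _).2 ?subrr ?eqxx ?mulr1 ?addr0//;
      exact: (Cintegral_character _).1.
  rewrite CintegralZ ?(Cintegral_character _).2 ?subr_eq0 ?(negbTE lk) ?mulr0//.
  exact: (Cintegral_character _).1.
have [|n y|y|intf cvf] := @Cintegral_cvg _ _ R leb u f (fun y => A * rho y) iu.
- apply: eq_integrable (integrableZl measurableT A irho) => //.
- rewrite /u !cabsM cabs_cis2pi mulr1 cabs_real (ger0_norm (ltW (rho_gt0 y))).
  by apply: ler_wpM2r; [exact: ltW|exact: (cabs_fourier_partial cA)].
- rewrite /f /u -mulrA mulrC; under [X in Ccvg X]eq_fun do rewrite -mulrA mulrC.
  by apply: CcvgZ; exact: (fourier_partial_cvg cA).
split=> //.
have [N0 kN0] : exists n, k \in cube n.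
  by exists (omega_hc k); exact: hyperbolic_cross_cube.
have ev : \forall n \near \oo, Cintegral leb setT (u n) = c k.
  by exists N0 => // n /= Nn; apply: cu; exact: cube_subset kN0.
have [cv1 cv2] := cvf; apply/eqP; rewrite eq_complex; apply/andP; split; apply/eqP.
  apply: (cvg_unique _ cv1) => //; apply: cvg_near_cst.
  by apply: filterS ev => n ->.
apply: (cvg_unique _ cv2) => //; apply: cvg_near_cst.
by apply: filterS ev => n ->.
Qed.

(** A summable Fourier series represents the function almost everywhere: the
    difference is orthogonal to all characters. *)
Lemma fourier_expansion : {ae leb, forall y, H y = F (xi y) * (rho y)%:C%C}.
Proof.
pose u y := H y - F (xi y) * (rho y)%:C%C.
have uk k : Cintegrable leb (fun y => u y * cis2pi (- zdot k (xi y))) /\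
    Cintegral leb setT (fun y => u y * cis2pi (- zdot k (xi y))) = 0.
  have [iF cF] := Cintegral_fourier_sum k.
  have iH := Cintegrable_weighted k.
  have iNF := CintegrableZ (-1) iF.
  have uE : (fun y => u y * cis2pi (- zdot k (xi y))) = (fun y =>
      H y * cis2pi (- zdot k (xi y)) +
      -1 * (F (xi y) * (rho y)%:C%C * cis2pi (- zdot k (xi y)))).
    by apply/funext => y; rewrite /u mulrBl mulN1r.
  rewrite uE; split; first exact: CintegrableD.
  by rewrite CintegralD// CintegralZ// cF -fourier_coefE mulN1r subrr.
(* real functions of integral zero, a class stable under linear combinations *)
pose zero (p : Rd -> R) := leb.-integrable setT (EFin \o p) /\
  (\int[leb]_y (p y)%:E = 0)%E.
have zeroD p q : zero p -> zero q -> zero (fun y => p y + q y).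
  move=> [ip p0] [iq q0]; split.
    by apply: eq_integrable (integrableD _ ip iq).
  by under eq_integral do rewrite EFinD; rewrite integralD// p0 q0 adde0.
have zeroZ a p : zero p -> zero (fun y => a * p y).
  move=> [ip p0]; split; first by apply: eq_integrable (integrableZl _ a ip).
  by under eq_integral do rewrite EFinM; rewrite integralZl// p0 mule0.
have R0 (p : Rd -> R) : leb.-integrable setT (EFin \o p) ->
    \int[leb]_y p y = 0 -> zero p.
  move=> ip p0; split=> //; rewrite -[LHS]fineK; last exact: integrable_fin_num.
  by rewrite -[fine _]/(\int[leb]_y p y) p0.
have Re0 k : zero (fun y => complex.Re (u y * cis2pi (- zdot k (xi y)))).
  by have [[i1 _] [e1 _]] := uk k; exact: R0.
have Im0 k : zero (fun y => complex.Im (u y * cis2pi (- zdot k (xi y)))).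
  by have [[_ i2] [_ e2]] := uk k; exact: R0.
have zdotN k x : zdot (- k) x = - zdot k x :> R.
  by rewrite /zdot -sumrN; apply: eq_bigr => i _; rewrite mxE intrN mulNr.
have ReE k y : complex.Re (u y * cis2pi (- zdot k (xi y))) =
    complex.Re (u y) * cos (2 * pi * zdot k (xi y)) +
    complex.Im (u y) * sin (2 * pi * zdot k (xi y)).
  by rewrite Re_mul /= mulrN cosN sinN mulrN opprK.
have ImE k y : complex.Im (u y * cis2pi (- zdot k (xi y))) =
    complex.Im (u y) * cos (2 * pi * zdot k (xi y)) -
    complex.Re (u y) * sin (2 * pi * zdot k (xi y)).
  by rewrite Im_mul /= mulrN cosN sinN mulrN addrC.
have cE k al y : @char_cos R d (fun i => transformation_inv (psi i)) k al y =
    cos (2 * pi * zdot k (xi y)) * cos al - sin (2 * pi * zdot k (xi y)) * sin al.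
  by rewrite /char_cos cosD.
have at0 y : u y * cis2pi (- zdot (0 : Zd) (xi y)) = u y.
  have -> : zdot (0 : Zd) (xi y) = 0.
    by rewrite /zdot big1// => i _; rewrite mxE mul0r.
  by rewrite oppr0 cis2pi0 mulr1.
have i1 : leb.-integrable setT (EFin \o (fun y => complex.Re (u y))).
  by apply: eq_integrable (Re0 0).1 => // y _; rewrite /= at0.
have i2 : leb.-integrable setT (EFin \o (fun y => complex.Im (u y))).
  by apply: eq_integrable (Im0 0).1 => // y _; rewrite /= at0.
have uniq0 := @trigonometric_uniqueness R d (fun i => transformation_inv (psi i)) _
  (measurable_transformation_inv psiT rhoC)
  (fun i => transformation_inv_unit (psiT i))
  (fun i => transformation_inv_lt (psiT i)).
have {}uniq1 := uniq0 _ i1 _; have {}uniq2 := uniq0 _ i2 _.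
(* with k and -k, the real parts of u against cosines and sines can be separated
   from the imaginary parts *)
have h1 : {ae leb, forall y, complex.Re (u y) = 0}.
  apply: uniq1 => k al.
  have [_ <-] := zeroD _ _ (zeroZ (cos al / 2) _ (zeroD _ _ (Re0 k) (Re0 (- k))))
    (zeroZ (sin al / 2) _ (zeroD _ _ (Im0 k) (zeroZ (-1) _ (Im0 (- k))))).
  apply: eq_integral => y _; congr EFin; rewrite cE !ReE !ImE zdotN mulrN cosN sinN.
  by field.
have h2 : {ae leb, forall y, complex.Im (u y) = 0}.
  apply: uniq2 => k al.
  have [_ <-] := zeroD _ _ (zeroZ (cos al / 2) _ (zeroD _ _ (Im0 k) (Im0 (- k))))
    (zeroZ (- sin al / 2) _ (zeroD _ _ (Re0 k) (zeroZ (-1) _ (Re0 (- k))))).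
  apply: eq_integral => y _; congr EFin; rewrite cE !ReE !ImE zdotN mulrN cosN sinN.
  by field.
apply: filterS2 h1 h2 => y y1 y2; apply/eqP; rewrite -subr_eq0 eq_complex.
by rewrite -/(u y) y1 y2 !eqxx.
Qed.

End expansion.

(** * The approximation error *)

Section norm_and_sampling.
Context {R : realType} {d : nat}.
Local Notation Zd := 'rV[int]_d.
Variables (psi om : 'I_d -> R -> R).

Lemma sum_cube_le_esum (a : Zd -> R) (s : R) :
  (forall k, 0 <= a k) -> (\esum_(k in [set: Zd]) (a k)%:E = s%:E)%E ->
  forall n, \sum_(k <- cube n) a k <= s.
Proof.
move=> a0 sE n; rewrite -lee_fin -sE; apply: esum_ge.
exists [set` cube n]; last by rewrite -fsbig_seq ?cube_uniq// sumEFin.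
by split => //; exact: finite_seq.
Qed.

(** The sampled function is the Fourier series of h, lattice points on the
    boundary of the cube included. *)
Lemma fourier_representativeE (h : 'rV[R]_d -> R[i]) :
  (forall k, torus_coef (transformed psi om h) k = fourier_coef psi om h k) ->
  fourier_representative (transformed psi om h) = fourier_sum (fourier_coef psi om h).
Proof.
move=> cE; apply/funext => x; rewrite /fourier_representative /fourier_sum.
congr Clim; apply/funext => n; rewrite /fourier_partial.
have -> : [set k : Zd | forall i, (`|k ord0 i| <= n)%N] = [set` cube n].
  by apply/seteqP; split => k /=; rewrite mem_cube => /forallP.
by rewrite -fsbig_seq ?cube_uniq//; apply: eq_bigr => k _; rewrite cE.
Qed.

Lemma approx_sumE (z : Zd) M N (h : 'rV[R]_d -> R[i]) y :
  approx_sum psi om z M (hyperbolic_cross N) h y =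
  (Num.sqrt (mdensity psi y / mweight om y))%:C%C *
  \sum_(k <- hc_seq N) approx_coef psi om z M h k *
    cis2pi (zdot k (mtransform_inv psi y)).
Proof.
rewrite /approx_sum (_ : hyperbolic_cross N = [set` hc_seq N]); last first.
  by apply/seteqP; split => k /=; rewrite mem_hc_seq.
rewrite -fsbig_seq ?hc_seq_uniq// mulr_sumr; apply: eq_bigr => k _.
by rewrite /phi; ring.
Qed.

End norm_and_sampling.

Theorem theorem3p6 (R : realType) (d m : nat) (lambda : R)
    (psi omega : 'I_d -> R -> R)
    (hd : (0 < d)%N) (hm : (0 < m)%N) (hlambda : 2^-1 < lambda)
    (hpsi : forall l, is_transformation (psi l))
    (homega : forall l, is_weight (omega l))
    (hrhoD : forall l, derivable_upto m setT (density (psi l)))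
    (hrhoC : forall l j, (j <= m)%N -> C0 (derive1n j (density (psi l))))
    (hpsiD : forall l, derivable_upto m unit_itv (psi l))
    (hpsiC : forall l j, (j <= m)%N ->
      {in unit_itv, continuous (derive1n j (psi l))})
    (hweightD : forall l,
      derivable_upto m unit_itv (transformed_weight (omega l) (psi l)))
    (hweight : forall mm : 'I_d -> nat, (forall l, mm l <= m)%N ->
      forall l,
      (\big[maxe/-oo]_(j < (mm l).+1)
         Linfty_torus (fun x =>
           (derive1n (mm l - j) (transformed_weight (omega l) (psi l)) x *
           derive1 (psi l) x `^ Num.max (- 2^-1) (2 * j%:R - 3 / 2))%R)
       < +oo)%E) :
  exists2 C : R, 0 < C &
    forall (N : nat) (z : 'rV[int]_d) (M : nat) (h : 'rV[R]_d -> R[i]),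
      (2 ^ d.+1 <= N)%N -> (0 < M)%N ->
      reconstructing z M (hyperbolic_cross N) ->
      L2_weighted (mweight omega) h -> Hmix m h ->
      (Linfty_weighted psi omega
         (fun y => h y -
            approx_sum psi omega z M (hyperbolic_cross N) h y)%R
       <= (C * N%:R `^ (- m%:R + lambda))%:E * Hm_norm psi omega m h)%E.
Proof.
have rhoC l : continuous (density (psi l)) by have [] := hrhoC l 0%N (leq0n m).
have [K K0 tail] := @hyperbolic_tail R d m lambda hm hlambda.
exists (2 * K); first by rewrite mulr_gt0.
move=> N z M h hN hM hrec hL2 _.
have N0 : (0 < N)%N by apply: leq_trans hN; rewrite expn_gt0.
have C0 : 0 < 2 * K * N%:R `^ (- m%:R + lambda).
  by rewrite !mulr_gt0// powR_gt0// ltr0n.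
pose c := fourier_coef psi omega h.
pose a (k : 'rV[int]_d) : R := (omega_hc k)%:R ^+ (2 * m) * cabs (c k) ^+ 2.
have a0 k : 0 <= a k by rewrite mulr_ge0 ?exprn_ge0 ?cabs_ge0.
have S0 : (0 <= \esum_(k in [set: 'rV[int]_d]) (a k)%:E)%E.
  by apply: esum_ge0 => k _; rewrite lee_fin.
rewrite /Hm_norm -/(esum _ _) poweR12_sqrt//.
case sE : (\esum_(k in [set: 'rV[int]_d]) (a k)%:E)%E S0 => [s| |] // s0;
  last by rewrite /= gt0_muley ?leey// lte_fin.
have cs := sum_cube_le_esum a0 sE.
have [A cA] := absolutely_summable hm cs.
have recN : reconstructing z M [set` hc_seq N].
  by move=> k1 k2 /=; rewrite !mem_hc_seq; exact: hrec.
rewrite -EFinM; apply/ess_supP.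
apply: filterS (fourier_expansion hpsi rhoC homega hL2 cA) => y Hy.
rewrite lee_fin.
have b0 : 0 <= 2 * K * N%:R `^ (- m%:R + lambda) * Num.sqrt s.
  by rewrite mulr_ge0 ?sqrtr_ge0// ltW.
have rho0 := mdensity_gt0 hpsi rhoC y.
have w0 := mweight_ge0 homega y.
(* where the weight vanishes, so does the weighted error *)
have [wE|wN0] := eqVneq (mweight omega y) 0.
  by rewrite wE mul0r sqrtr0 mul0r.
have wp : 0 < mweight omega y by rewrite lt_neqAle eq_sym wN0.
set r := mdensity psi y in Hy rho0 *; set w := mweight omega y in Hy w0 wN0 wp *.
have hE : h y = (Num.sqrt (r / w))%:C%C * fourier_sum c (mtransform_inv psi y).
  have rC : r%:C%C != 0 :> R[i] by rewrite eq_complex /= negb_and gt_eqF.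
  have rE : r = Num.sqrt (w * r) * Num.sqrt (r / w).
    rewrite -sqrtrM ?mulr_ge0 ?(ltW rho0)// (_ : w * r * (r / w) = r ^+ 2).
      by rewrite sqrtr_sqr gtr0_norm.
    by field; rewrite gt_eqF.
  apply: (mulIf rC); rewrite {1}rE rmorphM mulrA -[h y * _]/(weighted_fun psi omega h y).
  by rewrite Hy; ring.
rewrite hE approx_sumE -mulrBr cabsM cabs_real ger0_norm ?sqrtr_ge0// mulrA.
rewrite -sqrtrM ?divr_ge0// ?(ltW rho0)//.
rewrite (_ : w / r * (r / w) = 1); last by field; rewrite !gt_eqF.
rewrite sqrtr1 mul1r -!mulrA.
rewrite /approx_coef fourier_representativeE; last exact: torus_coefE.
apply: (fourier_sum_sampling_error cA _ hM (hc_seq_uniq N) recN) => n.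
by rewrite mulrA; exact: tail.
Qed.
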